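(* Let $X$ be a Banach space with property $( * )$, $Y\subset X$ a closed convex subset, $U\subset X$ an open set containing $Y$, and $f:U\to\mathbb{R}$ a function which is $\mathcal{C}^1$-smooth on $Y$ as a function on $U$. Then there is a $\mathcal{C}^1$-smooth function $H:X\to\mathbb{R}$ with $H|_Y=f|_Y$. Furthermore, there is a constant $C$ depending only on $X$ such that, if in addition $f$ is Lipschitz on $Y$, then $H$ can be chosen $\mathcal{C}^1$-smooth and Lipschitz on $X$ with $H|_Y=f|_Y$ and $\operatorname{Lip}(H)\le C\operatorname{Lip}(f|_Y)$.
   Context: A Banach space $X$ has property $( * )$ if there is a constant $C_0$, depending only on $X$, such that for every Lipschitz function $f:X\to\mathbb{R}$ and every $\varepsilon>0$ there is a Lipschitz, $\mathcal{C}^1$-smooth function $K:X\to\mathbb{R}$ with $|f(x)-K(x)|<\varepsilon$ for all $x\in X$ and $\operatorname{Lip}(K)\le C_0\operatorname{Lip}(f)$. A function $f:U\to\mathbb{R}$ ($U$ open, $Y\subset U$) is $\mathcal{C}^1$-smooth on $Y$ as a function on $U$ if $f$ is (Fréchet) differentiable at every point $y\in Y$ and the map $Y\to X^*$, $y\mapsto f'(y)$, is continuous on $Y$. *)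

(* Defs.v *)
From Stdlib Require Import Reals.
Open Scope R_scope.

Record NormedSpace := {
  ns_car :> Type;
  ns_zero : ns_car;
  ns_add : ns_car -> ns_car -> ns_car;
  ns_opp : ns_car -> ns_car;
  ns_scal : R -> ns_car -> ns_car;
  ns_norm : ns_car -> R;
  ns_add_assoc : forall x y z, ns_add x (ns_add y z) = ns_add (ns_add x y) z;
  ns_add_comm : forall x y, ns_add x y = ns_add y x;
  ns_add_zero : forall x, ns_add ns_zero x = x;
  ns_add_opp : forall x, ns_add (ns_opp x) x = ns_zero;
  ns_scal_one : forall x, ns_scal 1 x = x;
  ns_scal_assoc : forall a b x, ns_scal a (ns_scal b x) = ns_scal (a * b) x;
  ns_scal_distr_l : forall a x y, ns_scal a (ns_add x y) = ns_add (ns_scal a x) (ns_scal a y);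
  ns_scal_distr_r : forall a b x, ns_scal (a + b) x = ns_add (ns_scal a x) (ns_scal b x);
  ns_norm_eq0 : forall x, ns_norm x = 0 -> x = ns_zero;
  ns_norm_triangle : forall x y, ns_norm (ns_add x y) <= ns_norm x + ns_norm y;
  ns_norm_scal : forall a x, ns_norm (ns_scal a x) = Rabs a * ns_norm x
}.

Arguments ns_zero {n}.
Arguments ns_add {n}.
Arguments ns_opp {n}.
Arguments ns_scal {n}.
Arguments ns_norm {n}.

Definition ns_dist {X : NormedSpace} (x y : X) : R := ns_norm (ns_add x (ns_opp y)).

Definition complete (X : NormedSpace) : Prop :=
  forall u : nat -> X,
    (forall eps, 0 < eps -> exists N, forall m n, (N <= m)%nat -> (N <= n)%nat ->
        ns_dist (u m) (u n) < eps) ->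
    exists l : X, forall eps, 0 < eps -> exists N, forall n, (N <= n)%nat ->
        ns_dist (u n) l < eps.

Definition is_open {X : NormedSpace} (U : X -> Prop) : Prop :=
  forall x, U x -> exists r, 0 < r /\ forall z, ns_dist z x < r -> U z.

Definition is_closed {X : NormedSpace} (Y : X -> Prop) : Prop :=
  is_open (fun x => ~ Y x).

Definition is_convex {X : NormedSpace} (Y : X -> Prop) : Prop :=
  forall x y t, Y x -> Y y -> 0 <= t <= 1 ->
    Y (ns_add (ns_scal t x) (ns_scal (1 - t) y)).

Definition bounded_linear {X : NormedSpace} (L : X -> R) : Prop :=
  (forall x y, L (ns_add x y) = L x + L y) /\
  (forall a x, L (ns_scal a x) = a * L x) /\
  (exists M, forall x, Rabs (L x) <= M * ns_norm x).

Definition frechet_deriv {X : NormedSpace} (f : X -> R) (y : X) (L : X -> R) : Prop :=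
  bounded_linear L /\
  forall eps, 0 < eps -> exists delta, 0 < delta /\
    forall h, ns_norm h < delta ->
      Rabs (f (ns_add y h) - f y - L h) <= eps * ns_norm h.

(** f is C^1-smooth on Y (as a function on an open set containing Y):
    f is Frechet differentiable at every point of Y and y |-> f'(y) is
    continuous from Y to X^* (dual norm: ||A||<=eps iff |A h|<=eps||h|| for all h). *)
Definition C1_on {X : NormedSpace} (Y : X -> Prop) (f : X -> R) : Prop :=
  exists Df : X -> X -> R,
    (forall y, Y y -> frechet_deriv f y (Df y)) /\
    (forall y, Y y -> forall eps, 0 < eps -> exists delta, 0 < delta /\
       forall z, Y z -> ns_dist z y < delta ->
         forall h, Rabs (Df z h - Df y h) <= eps * ns_norm h).

Definition C1_smooth {X : NormedSpace} (f : X -> R) : Prop := C1_on (fun _ => True) f.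

Definition lipschitz_on {X : NormedSpace} (Y : X -> Prop) (L : R) (f : X -> R) : Prop :=
  forall x y, Y x -> Y y -> Rabs (f x - f y) <= L * ns_dist x y.

Definition lipschitz {X : NormedSpace} (L : R) (f : X -> R) : Prop :=
  lipschitz_on (fun _ => True) L f.

(** Property ( * ).  "Lip(K) <= C0 Lip(f)" is expressed as: K is (C0*L)-Lipschitz
    for every L >= 0 for which f is L-Lipschitz (Lip(f) is the least such L,
    and it is attained). *)
Definition property_star (X : NormedSpace) : Prop :=
  exists C0 : R, forall f : X -> R, (exists L, 0 <= L /\ lipschitz L f) ->
    forall eps, 0 < eps ->
      exists K : X -> R, C1_smooth K /\ (exists L, 0 <= L /\ lipschitz L K) /\
        (forall x, Rabs (f x - K x) < eps) /\
        (forall L, 0 <= L -> lipschitz L f -> lipschitz (C0 * L) K).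

(* Main.v *)
Require Import Defs.
From Stdlib Require Import Reals Lra List ClassicalEpsilon.
From mathcomp Require boolp classical_sets wochoice.
Open Scope R_scope.

(** C^1 smoothness on [X] is strict differentiability at every point, and on a
    convex [Y] the mean value inequality turns C^1 smoothness of [f] into strict
    differentiability of [f] relative to [Y]; this reduces all estimates to
    local Lipschitz constants.

    Near [a] in [Y], [f] is a bounded linear functional plus a function on [Y]
    with a small Lipschitz constant, and the latter extends to [X] (McShane) and
    can be smoothed by property ( * ).  These local approximants are blended
    along a sequence of smooth cutoffs carried by the sigma-discrete families
    of Stone's paracompactness theorem: the [n]-th approximant is taken so close
    to [f] that the slope of the [n]-th cutoff costs only [eps / 2^n].  This gives
    [g] with [f - g] being [eps]-Lipschitz on [Y].

    If [f] is [L]-Lipschitz on [Y], its derivatives are bounded by [L] on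
    [Y - Y], so Hahn-Banach makes the functionals, hence [g] near [Y],
    Lipschitz of order [L]; away from [Y], [g] is replaced by smoothings of a
    McShane extension.  Repeating this on [f - g] with [eps] halved each time and
    summing gives the extension.  The general case follows by first subtracting
    a [g] for which [f - g] is 1-Lipschitz on [Y]. *)

(** Property star gives closeness in value and a Lipschitz bound, never closeness of derivatives,
    whereas the iteration needs [f - g] to be small in slope. The way out is to smooth only
    remainders: if [G] is [e]-Lipschitz and [K] is its smoothing, then [K - G] is
    [(C + 1) * e]-Lipschitz by the triangle inequality alone. The loss factor [C] thus falls on a
    quantity that is made small beforehand, and it does not compound along the iteration, since each
    correction is measured against the current remainder. Closeness in value remains a free
    parameter and pays for the slopes of the cutoffs, which are not bounded uniformly: the
    separation of Stone's families shrinks with the level. In the final constant [2 * (7 * C + 1)],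
    the 2 sums the geometric series, 7 = 3 + 2 * 2 comes from comparing two distant points near [Y]
    through points of [Y], [C] from smoothing a McShane extension, and the 1 absorbs the blending
    error. *)

Lemma choice {S T : Type} (P : S -> T -> Prop) :
  (forall x, exists y, P x y) -> exists f, forall x, P x (f x).
Proof.
  intros H. exists (fun x => proj1_sig (constructive_indefinite_description _ (H x))).
  intros x. destruct constructive_indefinite_description; auto.
Qed.

(** * Vector identities *)

Section VectorIdentities.
Context {X : NormedSpace}.
Implicit Types (x y z : X) (l : list X).

Lemma add_zero_r x : ns_add x ns_zero = x.
Proof. rewrite ns_add_comm. apply ns_add_zero. Qed.

Lemma add_opp_r x : ns_add x (ns_opp x) = ns_zero.
Proof. rewrite ns_add_comm. apply ns_add_opp. Qed.

Lemma add_cancel_l x y z : ns_add x y = ns_add x z -> y = z.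
Proof.
  intros H. rewrite <- (ns_add_zero X y), <- (ns_add_zero X z), <- (ns_add_opp X x).
  rewrite <- !ns_add_assoc, H. reflexivity.
Qed.

Lemma scal_zero_l x : ns_scal 0 x = ns_zero.
Proof.
  apply (add_cancel_l (ns_scal 0 x)).
  rewrite <- ns_scal_distr_r, Rplus_0_r, add_zero_r. reflexivity.
Qed.

Lemma scal_zero_r a : ns_scal a (@ns_zero X) = ns_zero.
Proof.
  rewrite <- (scal_zero_l ns_zero), ns_scal_assoc, Rmult_0_r. reflexivity.
Qed.

Lemma opp_scal x : ns_opp x = ns_scal (-1) x.
Proof.
  apply (add_cancel_l x). rewrite add_opp_r.
  rewrite <- (ns_scal_one X x) at 1. rewrite <- ns_scal_distr_r.
  replace (1 + -1) with 0 by ring. symmetry. apply scal_zero_l.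
Qed.

(** Syntax for proof by reflection: every vector expression is a linear combination of its atoms, so
    an identity follows from equality of coefficients. *)
Inductive vexp :=
| VAtom (n : nat) | VZero | VAdd (a b : vexp) | VOpp (a : vexp) | VScal (r : R) (a : vexp).

Fixpoint veval l e : X :=
  match e with
  | VAtom n => nth n l ns_zero
  | VZero => ns_zero
  | VAdd a b => ns_add (veval l a) (veval l b)
  | VOpp a => ns_opp (veval l a)
  | VScal r a => ns_scal r (veval l a)
  end.

Fixpoint vcoef e (i : nat) : R :=
  match e with
  | VAtom n => if Nat.eqb n i then 1 else 0
  | VZero => 0
  | VAdd a b => vcoef a i + vcoef b i
  | VOpp a => - vcoef a i
  | VScal r a => r * vcoef a i
  end.

Fixpoint vcomb (c : nat -> R) l : X :=
  match l with
  | nil => ns_zero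
  | x :: l' => ns_add (ns_scal (c 0%nat) x) (vcomb (fun i => c (S i)) l')
  end.

(** A finite conjunction along the list instead of a quantifier over indices, so that [simpl] leaves
    concrete equations between reals. *)
Fixpoint same_coef (c d : nat -> R) l : Prop :=
  match l with
  | nil => True
  | _ :: l' => c 0%nat = d 0%nat /\ same_coef (fun i => c (S i)) (fun i => d (S i)) l'
  end.

Lemma vcomb_ext l : forall c d, same_coef c d l -> vcomb c l = vcomb d l.
Proof.
  induction l as [|x l IH]; simpl; intros c d H; [reflexivity|].
  destruct H as [H1 H2]. rewrite H1, (IH _ _ H2). reflexivity.
Qed.

Lemma vcomb_zero l : vcomb (fun _ => 0) l = ns_zero.
Proof.
  induction l as [|x l IH]; simpl; [reflexivity|].
  rewrite IH, scal_zero_l. apply ns_add_zero.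
Qed.

Lemma vcomb_add l : forall c d,
  vcomb (fun i => c i + d i) l = ns_add (vcomb c l) (vcomb d l).
Proof.
  induction l as [|x l IH]; simpl; intros c d; [symmetry; apply ns_add_zero|].
  rewrite (IH (fun i => c (S i)) (fun i => d (S i))), ns_scal_distr_r.
  rewrite <- !ns_add_assoc. f_equal. rewrite !ns_add_assoc. f_equal. apply ns_add_comm.
Qed.

Lemma vcomb_scal l r : forall c, vcomb (fun i => r * c i) l = ns_scal r (vcomb c l).
Proof.
  induction l as [|x l IH]; simpl; intros c; [symmetry; apply scal_zero_r|].
  rewrite (IH (fun i => c (S i))), ns_scal_distr_l, ns_scal_assoc. reflexivity.
Qed.

Lemma vcomb_atom l : forall n,
  vcomb (fun i => if Nat.eqb n i then 1 else 0) l = nth n l ns_zero.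
Proof.
  induction l as [|x l IH]; intros [|n]; simpl; auto.
  - rewrite vcomb_zero, ns_scal_one. apply add_zero_r.
  - rewrite IH, scal_zero_l. apply ns_add_zero.
Qed.

Lemma veval_vcomb l e : veval l e = vcomb (vcoef e) l.
Proof.
  induction e; simpl.
  - symmetry. apply vcomb_atom.
  - symmetry. apply vcomb_zero.
  - rewrite IHe1, IHe2. symmetry. apply vcomb_add.
  - rewrite IHe, opp_scal, <- vcomb_scal. apply vcomb_ext.
    clear IHe. generalize (vcoef e).
    induction l as [|x l IH]; simpl; intros c; [exact I|].
    split; [ring|apply (IH (fun i => c (S i)))].
  - rewrite IHe, <- vcomb_scal. reflexivity.
Qed.

Lemma veval_eq l e1 e2 : same_coef (vcoef e1) (vcoef e2) l -> veval l e1 = veval l e2.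
Proof. intros H. rewrite !veval_vcomb. apply vcomb_ext, H. Qed.

End VectorIdentities.

Ltac vmem x l :=
  match l with
  | nil => constr:(false)
  | x :: _ => constr:(true)
  | _ :: ?l' => vmem x l'
  end.
Ltac vadd x l := match vmem x l with true => l | false => constr:(x :: l) end.
Ltac vatoms e l :=
  match e with
  | ns_add ?a ?b => let l1 := vatoms a l in vatoms b l1
  | ns_opp ?a => vatoms a l
  | ns_scal _ ?a => vatoms a l
  | ns_zero => l
  | _ => vadd e l
  end.
Ltac vindex x l :=
  match l with
  | x :: _ => constr:(0%nat)
  | _ :: ?l' => let n := vindex x l' in constr:(S n)
  end.
Ltac vreify e l :=
  match e with
  | ns_add ?a ?b => let u := vreify a l in let v := vreify b l in constr:(VAdd u v)
  | ns_opp ?a => let u := vreify a l in constr:(VOpp u)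
  | ns_scal ?r ?a => let u := vreify a l in constr:(VScal r u)
  | ns_zero => constr:(VZero)
  | _ => let n := vindex e l in constr:(VAtom n)
  end.
(* Reduces an equation between vector expressions to one real equation per
   atom, left to [field]. *)
Ltac vec :=
  match goal with
  | |- @eq (ns_car ?X) ?a ?b =>
      let l0 := vatoms a (@nil (ns_car X)) in
      let l := vatoms b l0 in
      let u := vreify a l in
      let v := vreify b l in
      change (veval l u = veval l v); apply veval_eq; simpl;
      repeat split; try field
  end.

(** * Norm and distance *)

Section Metric.
Context {X : NormedSpace}.
Implicit Types (x y z h : X).

Lemma norm_zero : ns_norm (@ns_zero X) = 0.
Proof. rewrite <- (scal_zero_l ns_zero), ns_norm_scal, Rabs_R0. ring. Qed.

Lemma norm_opp x : ns_norm (ns_opp x) = ns_norm x.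
Proof.
  rewrite opp_scal, ns_norm_scal, Rabs_left by lra. ring.
Qed.

Lemma norm_ge0 x : 0 <= ns_norm x.
Proof.
  pose proof (ns_norm_triangle X x (ns_opp x)) as H.
  rewrite add_opp_r, norm_zero, norm_opp in H. lra.
Qed.

Lemma dist_ge0 x y : 0 <= ns_dist x y.
Proof. apply norm_ge0. Qed.

Lemma dist_self x : ns_dist x x = 0.
Proof. unfold ns_dist. rewrite add_opp_r. apply norm_zero. Qed.

Lemma ns_dist_sym x y : ns_dist x y = ns_dist y x.
Proof. unfold ns_dist. rewrite <- norm_opp. f_equal. vec. Qed.

Lemma ns_dist_tri x y z : ns_dist x z <= ns_dist x y + ns_dist y z.
Proof.
  unfold ns_dist. eapply Rle_trans; [|apply ns_norm_triangle].
  apply Req_le. f_equal. vec.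
Qed.

Lemma dist_add x h : ns_dist (ns_add x h) x = ns_norm h.
Proof. unfold ns_dist. f_equal. vec. Qed.

Lemma dist_segment x y s t :
  ns_dist (ns_add x (ns_scal s (ns_add y (ns_opp x))))
          (ns_add x (ns_scal t (ns_add y (ns_opp x)))) = Rabs (s - t) * ns_dist y x.
Proof. unfold ns_dist. rewrite <- ns_norm_scal. f_equal. vec. Qed.

End Metric.

(** * Mean value inequality *)

(** Continuous induction on the set of times up to which the bound [c * t] holds: the local estimate
    at its supremum first puts the supremum in the set, then reaches beyond it unless it is 1. *)
Lemma chain_bound (phi : R -> R) (c : R) :
  (forall t, 0 <= t <= 1 -> exists d, 0 < d /\
     forall s, 0 <= s <= 1 -> Rabs (s - t) < d -> Rabs (phi s - phi t) <= c * Rabs (s - t)) ->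
  Rabs (phi 1 - phi 0) <= c.
Proof.
  intros Hloc.
  set (E := fun t => 0 <= t <= 1 /\ Rabs (phi t - phi 0) <= c * t).
  assert (E0 : E 0).
  { split; [lra|]. unfold Rminus. rewrite Rplus_opp_r, Rabs_R0. lra. }
  assert (Hub : bound E) by (exists 1; intros t [? ?]; lra).
  destruct (completeness E Hub (ex_intro _ 0 E0)) as [tau [Hup Hleast]].
  assert (Htau : 0 <= tau <= 1).
  { split; [apply Hup, E0|]. apply Hleast. intros t [? ?]; lra. }
  destruct (Hloc tau Htau) as [d [Hd Hphi]].
  assert (Hs : exists s, E s /\ tau - d < s <= tau).
  { apply NNPP. intros Hno.
    assert (tau <= tau - d); [|lra].
    apply Hleast. intros t Ht.
    destruct (Rle_lt_dec t (tau - d)); [assumption|].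
    exfalso. apply Hno. exists t. split; [assumption|]. split; [assumption|apply Hup, Ht]. }
  destruct Hs as [s [[Hs01 Hs] Hsd]].
  assert (Etau : E tau).
  { split; [assumption|].
    assert (H := Hphi s Hs01). rewrite (Rabs_left1 (s - tau)) in H by lra.
    specialize (H ltac:(lra)).
    replace (phi tau - phi 0) with (- (phi s - phi tau) + (phi s - phi 0)) by ring.
    eapply Rle_trans; [apply Rabs_triang|]. rewrite Rabs_Ropp. lra. }
  destruct (Req_dec tau 1) as [->|Hne]; [destruct Etau; lra|].
  set (s' := Rmin 1 (tau + d / 2)).
  assert (Hs' : tau < s' <= 1 /\ s' <= tau + d / 2).
  { unfold s'. unfold Rmin. destruct (Rle_dec 1 (tau + d/2)); lra. }
  assert (E s'); [|exfalso; pose proof (Hup s' H); lra].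
  split; [lra|].
  assert (H := Hphi s' ltac:(lra)). rewrite (Rabs_right (s' - tau)) in H by lra.
  specialize (H ltac:(lra)). destruct Etau as [_ Et].
  replace (phi s' - phi 0) with ((phi s' - phi tau) + (phi tau - phi 0)) by ring.
  eapply Rle_trans; [apply Rabs_triang|]. lra.
Qed.

Section MeanValue.
Context {X : NormedSpace}.
Implicit Types (x y z w : X) (A B : X -> Prop) (u f : X -> R).

Lemma convex_segment A x y t : is_convex A -> A x -> A y -> 0 <= t <= 1 ->
  A (ns_add x (ns_scal t (ns_add y (ns_opp x)))).
Proof.
  intros HA Hx Hy Ht.
  replace (ns_add x (ns_scal t (ns_add y (ns_opp x))))
    with (ns_add (ns_scal t y) (ns_scal (1 - t) x)) by vec.
  apply HA; auto.
Qed.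

Lemma convex_local_lipschitz A u c : is_convex A ->
  (forall x, A x -> exists d, 0 < d /\
     forall z, A z -> ns_dist z x < d -> Rabs (u z - u x) <= c * ns_dist z x) ->
  lipschitz_on A c u.
Proof.
  intros HA Hloc x y Hx Hy.
  set (p := fun t => ns_add y (ns_scal t (ns_add x (ns_opp y)))).
  assert (Hp1 : p 1 = x) by (unfold p; vec).
  assert (Hp0 : p 0 = y) by (unfold p; vec).
  rewrite <- Hp1 at 1. rewrite <- Hp0 at 1.
  apply (chain_bound (fun t => u (p t)) (c * ns_dist x y)).
  intros t Ht.
  destruct (Hloc (p t)) as [d [Hd Hu]].
  { apply convex_segment; auto. }
  pose proof (dist_ge0 x y) as Hxy.
  (* The [+ 1] keeps the quotient meaningful when [x = y]. *)
  exists (d / (ns_dist x y + 1)). split; [apply Rdiv_lt_0_compat; lra|].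
  intros s Hs Hst.
  eapply Rle_trans; [apply Hu|].
  - apply convex_segment; auto.
  - unfold p. rewrite dist_segment.
    apply Rle_lt_trans with (Rabs (s - t) * (ns_dist x y + 1)).
    + apply Rmult_le_compat_l; [apply Rabs_pos|lra].
    + apply (Rmult_lt_compat_r (ns_dist x y + 1)) in Hst; [|lra].
      unfold Rdiv in Hst. rewrite Rmult_assoc, Rinv_l in Hst by lra. lra.
  - unfold p. rewrite dist_segment. apply Req_le. ring.
Qed.

Lemma convex_ball A x r : is_convex A -> is_convex (fun z => A z /\ ns_dist z x < r).
Proof.
  intros HA z w t [Hz Hzr] [Hw Hwr] Ht. split; [apply HA; auto|].
  unfold ns_dist in *.
  replace (ns_add (ns_add (ns_scal t z) (ns_scal (1 - t) w)) (ns_opp x))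
    with (ns_add (ns_scal t (ns_add z (ns_opp x))) (ns_scal (1 - t) (ns_add w (ns_opp x)))) by vec.
  eapply Rle_lt_trans; [apply ns_norm_triangle|].
  rewrite !ns_norm_scal, !Rabs_right by lra.
  destruct (Rle_lt_dec t 0).
  - replace t with 0 by lra. lra.
  - assert (t * ns_norm (ns_add z (ns_opp x)) < t * r) by (apply Rmult_lt_compat_l; lra).
    assert ((1 - t) * ns_norm (ns_add w (ns_opp x)) <= (1 - t) * r)
      by (apply Rmult_le_compat_l; lra).
    lra.
Qed.

Lemma convex_full : is_convex (fun _ : X => True).
Proof. intros ? ? ? ? ? ?. exact I. Qed.

End MeanValue.

(** * Strict differentiability relative to a set *)

Lemma Rabs_le_inv a b : Rabs a <= b -> - b <= a <= b.
Proof. unfold Rabs; destruct Rcase_abs; lra. Qed.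

Section StrictDiff.
Context {X : NormedSpace}.
Implicit Types (x y z w h : X) (A B : X -> Prop) (u v f g : X -> R).

Lemma bl_zero : bounded_linear (fun _ : X => 0).
Proof.
  repeat split; intros; try ring.
  exists 0. intros. rewrite Rabs_R0. lra.
Qed.

Lemma bl_comb a b (l m : X -> R) : bounded_linear l -> bounded_linear m ->
  bounded_linear (fun x => a * l x + b * m x).
Proof.
  intros [la [ls [L HL]]] [ma [ms [M HM]]]. repeat split.
  - intros. rewrite la, ma. ring.
  - intros. rewrite ls, ms. ring.
  - exists (Rabs a * L + Rabs b * M). intros x.
    eapply Rle_trans; [apply Rabs_triang|]. rewrite !Rabs_mult.
    pose proof (Rmult_le_compat_l (Rabs a) _ _ (Rabs_pos a) (HL x)).
    pose proof (Rmult_le_compat_l (Rabs b) _ _ (Rabs_pos b) (HM x)).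
    lra.
Qed.

Lemma bl_sub (l : X -> R) x y : bounded_linear l ->
  l (ns_add x (ns_opp y)) = l x - l y.
Proof. intros [la [ls _]]. rewrite opp_scal, la, ls. ring. Qed.

Lemma bl_bound (l : X -> R) : bounded_linear l ->
  exists M, 0 <= M /\ forall x, Rabs (l x) <= M * ns_norm x.
Proof.
  intros [_ [_ [M HM]]]. exists (Rabs M). split; [apply Rabs_pos|].
  intros x. eapply Rle_trans; [apply HM|].
  apply Rmult_le_compat_r; [apply norm_ge0|apply Rle_abs].
Qed.

Definition lin_approx A f x (e : R) (l : X -> R) : Prop :=
  bounded_linear l /\ exists d, 0 < d /\
    forall z w, A z -> A w -> ns_dist z x < d -> ns_dist w x < d ->
      Rabs (f z - f w - l (ns_add z (ns_opp w))) <= e * ns_dist z w.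

(* For [A] the whole space, strict differentiability at every point is C^1
   smoothness; it makes sense and is stable under sums, products and Lipschitz
   limits without mentioning the derivative. *)
Definition strict_diff A f x : Prop :=
  forall e, 0 < e -> exists l, lin_approx A f x e l.

Definition smooth f : Prop := forall x, strict_diff (fun _ => True) f x.

Definition near_lip A c f x : Prop :=
  exists d, 0 < d /\ forall z w, A z -> A w -> ns_dist z x < d -> ns_dist w x < d ->
    Rabs (f z - f w) <= c * ns_dist z w.

Lemma near_lip_local A B c f g x :
  (exists d, 0 < d /\ (forall z, A z -> ns_dist z x < d -> B z) /\
     forall z w, A z -> A w -> ns_dist z x < d -> ns_dist w x < d -> g z - g w = f z - f w) ->
  near_lip B c f x -> near_lip A c g x.
Proof.
  intros [d [Hd [HB Hfg]]] [e [He H]]. exists (Rmin d e).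
  split; [apply Rmin_glb_lt; auto|]. intros z w Az Aw Hz Hw.
  pose proof (Rmin_l d e). pose proof (Rmin_r d e).
  rewrite Hfg by (auto; lra). apply H; try apply HB; auto; lra.
Qed.

Lemma near_lip_le A c c' f x : c <= c' -> near_lip A c f x -> near_lip A c' f x.
Proof.
  intros Hc [d [Hd H]]. exists d. split; [auto|]. intros z w Az Aw Hz Hw.
  eapply Rle_trans; [apply H; auto|]. apply Rmult_le_compat_r; [apply dist_ge0|auto].
Qed.

Lemma near_lip_add A a b f g x : near_lip A a f x -> near_lip A b g x ->
  near_lip A (a + b) (fun z => f z + g z) x.
Proof.
  intros [d [Hd Hf]] [e [He Hg]]. exists (Rmin d e).
  split; [apply Rmin_glb_lt; auto|]. intros z w Az Aw Hz Hw.
  pose proof (Rmin_l d e). pose proof (Rmin_r d e).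
  replace (f z + g z - (f w + g w)) with ((f z - f w) + (g z - g w)) by ring.
  eapply Rle_trans; [apply Rabs_triang|].
  specialize (Hf z w Az Aw ltac:(lra) ltac:(lra)).
  specialize (Hg z w Az Aw ltac:(lra) ltac:(lra)). lra.
Qed.

Lemma near_lip_convex A c f : is_convex A ->
  (forall x, A x -> near_lip A c f x) -> lipschitz_on A c f.
Proof.
  intros HA H. apply convex_local_lipschitz; auto. intros x Hx.
  destruct (H x Hx) as [d [Hd Hf]]. exists d. split; auto. intros z Hz Hzx.
  apply Hf; auto. rewrite dist_self; auto.
Qed.

Lemma strict_diff_near_lip A f x : strict_diff A f x ->
  exists c, 0 <= c /\ near_lip A c f x.
Proof.
  intros H. destruct (H 1 Rlt_0_1) as [l [Hl [d [Hd Hf]]]].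
  destruct (bl_bound l Hl) as [M [HM HlM]].
  exists (1 + M). split; [lra|]. exists d. split; auto. intros z w Az Aw Hz Hw.
  specialize (Hf z w Az Aw Hz Hw). specialize (HlM (ns_add z (ns_opp w))).
  fold (ns_dist z w) in HlM.
  replace (f z - f w) with (f z - f w - l (ns_add z (ns_opp w)) + l (ns_add z (ns_opp w))) by ring.
  eapply Rle_trans; [apply Rabs_triang|]. lra.
Qed.

Lemma strict_diff_local A B f g x :
  (exists d, 0 < d /\ forall z, A z -> ns_dist z x < d -> B z /\ f z = g z) ->
  strict_diff B f x -> strict_diff A g x.
Proof.
  intros [d [Hd Hfg]] H e He. destruct (H e He) as [l [Hl [d' [Hd' Hf]]]].
  exists l. split; auto. exists (Rmin d d').
  split; [apply Rmin_glb_lt; auto|]. intros z w Az Aw Hz Hw.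
  pose proof (Rmin_l d d'). pose proof (Rmin_r d d').
  destruct (Hfg z Az ltac:(lra)) as [Bz <-].
  destruct (Hfg w Aw ltac:(lra)) as [Bw <-].
  apply Hf; auto; lra.
Qed.

Lemma strict_diff_const A c x : strict_diff A (fun _ => c) x.
Proof.
  intros e He. exists (fun _ => 0). split; [apply bl_zero|].
  exists 1. split; [lra|]. intros z w _ _ _ _.
  replace (c - c - 0) with 0 by ring. rewrite Rabs_R0.
  apply Rmult_le_pos; [lra|apply dist_ge0].
Qed.

Lemma strict_diff_linear A l x : bounded_linear l -> strict_diff A l x.
Proof.
  intros Hl e He. exists l. split; auto. exists 1. split; [lra|]. intros z w _ _ _ _.
  rewrite bl_sub by auto. replace (l z - l w - (l z - l w)) with 0 by ring.
  rewrite Rabs_R0. apply Rmult_le_pos; [lra|apply dist_ge0].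
Qed.

Lemma strict_diff_comb A a b f g x : strict_diff A f x -> strict_diff A g x ->
  strict_diff A (fun z => a * f z + b * g z) x.
Proof.
  intros Hf Hg e He.
  pose proof (Rabs_pos a) as Ha. pose proof (Rabs_pos b) as Hb.
  set (k := Rabs a + Rabs b + 1).
  destruct (Hf (e / k)) as [l [Hl [d [Hd H]]]]; [apply Rdiv_lt_0_compat; unfold k; lra|].
  destruct (Hg (e / k)) as [m [Hm [d' [Hd' H']]]]; [apply Rdiv_lt_0_compat; unfold k; lra|].
  exists (fun x => a * l x + b * m x). split; [apply bl_comb; auto|].
  exists (Rmin d d'). split; [apply Rmin_glb_lt; auto|]. intros z w Az Aw Hz Hw.
  pose proof (Rmin_l d d'). pose proof (Rmin_r d d').
  specialize (H z w Az Aw ltac:(lra) ltac:(lra)).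
  specialize (H' z w Az Aw ltac:(lra) ltac:(lra)).
  set (v := ns_add z (ns_opp w)) in *.
  replace (a * f z + b * g z - (a * f w + b * g w) - (a * l v + b * m v))
    with (a * (f z - f w - l v) + b * (g z - g w - m v)) by ring.
  eapply Rle_trans; [apply Rabs_triang|]. rewrite !Rabs_mult.
  apply (Rmult_le_compat_l (Rabs a)) in H; [|auto].
  apply (Rmult_le_compat_l (Rabs b)) in H'; [|auto].
  replace (e * ns_dist z w) with
    (Rabs a * (e / k * ns_dist z w) + Rabs b * (e / k * ns_dist z w) + e / k * ns_dist z w).
  - assert (0 <= e / k * ns_dist z w); [|lra].
    apply Rmult_le_pos; [|apply dist_ge0]. apply Rlt_le, Rdiv_lt_0_compat; unfold k; lra.
  - unfold k. field. lra.
Qed.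

Lemma strict_diff_add A f g x : strict_diff A f x -> strict_diff A g x ->
  strict_diff A (fun z => f z + g z) x.
Proof.
  intros Hf Hg.
  apply (strict_diff_local A A (fun z => 1 * f z + 1 * g z)).
  - exists 1. split; [lra|]. intros; split; auto; ring.
  - apply strict_diff_comb; auto.
Qed.

Lemma strict_diff_sub A f g x : strict_diff A f x -> strict_diff A g x ->
  strict_diff A (fun z => f z - g z) x.
Proof.
  intros Hf Hg.
  apply (strict_diff_local A A (fun z => 1 * f z + (-1) * g z)).
  - exists 1. split; [lra|]. intros; split; auto; ring.
  - apply strict_diff_comb; auto.
Qed.

Definition strict_diff_R (p : R -> R) : Prop :=
  forall t e, 0 < e -> exists m d, 0 < d /\
    forall a b, Rabs (a - t) < d -> Rabs (b - t) < d ->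
      Rabs (p a - p b - m * (a - b)) <= e * Rabs (a - b).

Lemma strict_diff_comp p f x : strict_diff_R p ->
  strict_diff (fun _ => True) f x -> strict_diff (fun _ => True) (fun z => p (f z)) x.
Proof.
  intros Hp Hf e He.
  destruct (strict_diff_near_lip _ f x Hf) as [c [Hc [d1 [Hd1 Hlip]]]].
  destruct (Hp (f x) (e / (2 * (c + 1)))) as [m [d2 [Hd2 Hm]]].
  { apply Rdiv_lt_0_compat; lra. }
  pose proof (Rabs_pos m) as Hm0.
  destruct (Hf (e / (2 * (Rabs m + 1)))) as [l [Hl [d3 [Hd3 H3]]]].
  { apply Rdiv_lt_0_compat; lra. }
  (* The term with coefficient 0 only brings the functional into the shape of [bl_comb]. *)
  exists (fun x => m * l x + 0 * l x). split; [apply bl_comb; auto|].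
  set (d4 := d2 / (c + 1)).
  assert (Hd4 : 0 < d4) by (apply Rdiv_lt_0_compat; lra).
  exists (Rmin d1 (Rmin d3 d4)).
  split; [repeat apply Rmin_glb_lt; auto|].
  intros z w _ _ Hz Hw.
  pose proof (Rmin_l d1 (Rmin d3 d4)). pose proof (Rmin_r d1 (Rmin d3 d4)).
  pose proof (Rmin_l d3 d4). pose proof (Rmin_r d3 d4).
  assert (Hnear : forall y, ns_dist y x < d1 -> ns_dist y x < d4 -> Rabs (f y - f x) < d2).
  { intros y Hy Hy4. eapply Rle_lt_trans.
    - apply Hlip; auto. rewrite dist_self; auto.
    - pose proof (dist_ge0 y x).
      apply Rle_lt_trans with ((c + 1) * ns_dist y x); [nra|].
      apply (Rmult_lt_compat_l (c + 1)) in Hy4; [|lra].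
      unfold d4 in Hy4. replace ((c + 1) * (d2 / (c + 1))) with d2 in Hy4 by (field; lra).
      lra. }
  assert (A1 := Hm (f z) (f w) (Hnear z ltac:(lra) ltac:(lra)) (Hnear w ltac:(lra) ltac:(lra))).
  assert (A2 := Hlip z w I I ltac:(lra) ltac:(lra)).
  assert (A3 := H3 z w I I ltac:(lra) ltac:(lra)).
  set (v := ns_add z (ns_opp w)) in *.
  pose proof (dist_ge0 z w) as Hzw.
  replace (p (f z) - p (f w) - (m * l v + 0 * l v))
    with ((p (f z) - p (f w) - m * (f z - f w)) + m * (f z - f w - l v)) by ring.
  eapply Rle_trans; [apply Rabs_triang|]. rewrite Rabs_mult.
  apply (Rmult_le_compat_l (Rabs m)) in A3; [|auto].
  assert (A4 : e / (2 * (c + 1)) * Rabs (f z - f w) <= e / (2 * (c + 1)) * ((c + 1) * ns_dist z w)).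
  { apply Rmult_le_compat_l; [apply Rlt_le, Rdiv_lt_0_compat; lra|]. nra. }
  replace (e / (2 * (c + 1)) * ((c + 1) * ns_dist z w)) with (e / 2 * ns_dist z w) in A4
    by (field; lra).
  assert (A5 : Rabs m * (e / (2 * (Rabs m + 1)) * ns_dist z w) <= e / 2 * ns_dist z w).
  { rewrite <- Rmult_assoc. apply Rmult_le_compat_r; auto.
    apply Rmult_le_reg_r with (2 * (Rabs m + 1)); [lra|].
    replace (Rabs m * (e / (2 * (Rabs m + 1))) * (2 * (Rabs m + 1))) with (Rabs m * e)
      by (field; lra).
    replace (e / 2 * (2 * (Rabs m + 1))) with (Rabs m * e + e) by field. lra. }
  lra.
Qed.

Lemma strict_diff_square : strict_diff_R (fun t => t * t).
Proof.
  intros t e He. exists (2 * t), (e / 2). split; [lra|]. intros a b Ha Hb.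
  replace (a * a - b * b - 2 * t * (a - b)) with (((a - t) + (b - t)) * (a - b)) by ring.
  rewrite Rabs_mult. apply Rmult_le_compat_r; [apply Rabs_pos|].
  eapply Rle_trans; [apply Rabs_triang|]. lra.
Qed.

Lemma Rmax_0_lip a b : Rabs (Rmax 0 a - Rmax 0 b) <= Rabs (a - b).
Proof. unfold Rmax, Rabs; repeat destruct Rle_dec; repeat destruct Rcase_abs; lra. Qed.

(** The squared positive part is C^1 with derivative [2 * Rmax 0 t]; it is the one-variable
    ingredient of all cutoffs. *)
Lemma strict_diff_sqr_pos : strict_diff_R (fun t => Rmax 0 t * Rmax 0 t).
Proof.
  intros t e He. exists (2 * Rmax 0 t), (e / 2). split; [lra|]. intros a b Ha Hb.
  assert (Ha' := Rle_lt_trans _ _ _ (Rmax_0_lip a t) Ha).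
  assert (Hb' := Rle_lt_trans _ _ _ (Rmax_0_lip b t) Hb).
  revert Ha' Hb'. unfold Rmax. destruct (Rle_dec 0 a), (Rle_dec 0 b), (Rle_dec 0 t);
  unfold Rabs; repeat destruct Rcase_abs; intros; nra.
Qed.

(** Polarisation expresses the product by squares of [f + g], [f] and [g], so the chain rule for
    squaring replaces a product estimate. *)
Lemma strict_diff_mul f g x :
  strict_diff (fun _ => True) f x -> strict_diff (fun _ => True) g x ->
  strict_diff (fun _ => True) (fun z => f z * g z) x.
Proof.
  intros Hf Hg.
  set (q := fun t : R => t * t).
  apply (strict_diff_local _ (fun _ => True)
    (fun z => (/2) * q (f z + g z) + (-/2) * (1 * q (f z) + 1 * q (g z)))).
  { exists 1. split; [lra|]. intros. split; auto. unfold q. field. }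
  assert (Hq : strict_diff_R q) by apply strict_diff_square.
  apply strict_diff_comb; [|apply strict_diff_comb];
    apply (strict_diff_comp q); auto.
  apply strict_diff_add; auto.
Qed.

(** Near [y] the function [f - Df y] has pointwise slope at most [e]: half from differentiability at
    the current point, half from continuity of [Df]. The trace of a ball on [A] is convex, so the
    mean value inequality makes this a bound for pairs. *)
Lemma C1_on_strict_diff A f y : is_convex A -> C1_on A f -> A y -> strict_diff A f y.
Proof.
  intros HA [Df [Hder Hcont]] Hy e He.
  destruct (Hcont y Hy (e / 2)) as [d [Hd Hc]]; [lra|].
  assert (Hly : bounded_linear (Df y)) by (apply Hder; auto).
  exists (Df y). split; auto.
  exists d. split; auto. intros z w Az Aw Hz Hw.
  rewrite bl_sub by auto.
  replace (f z - f w - (Df y z - Df y w)) with ((f z - Df y z) - (f w - Df y w)) by ring.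
  apply (convex_local_lipschitz (fun x => A x /\ ns_dist x y < d) (fun x => f x - Df y x) e);
    auto; [apply convex_ball; auto|].
  intros x [Ax Hx]. destruct (Hder x Ax) as [Hlx Hfr].
  destruct (Hfr (e / 2)) as [r [Hr Hfx]]; [lra|].
  exists r. split; auto. intros z' _ Hz'.
  set (h := ns_add z' (ns_opp x)).
  assert (Ez : z' = ns_add x h) by (unfold h; vec).
  specialize (Hfx h Hz'). specialize (Hc x Ax Hx h). rewrite <- Ez in Hfx.
  fold (ns_norm h) in *. change (ns_dist z' x) with (ns_norm h).
  replace (f z' - Df y z' - (f x - Df y x)) with
    ((f z' - f x - Df x h) + (Df x h - Df y h)).
  - eapply Rle_trans; [apply Rabs_triang|]. lra.
  - unfold h. rewrite (bl_sub (Df y)) by auto. ring.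
Qed.

Lemma C1_smooth_smooth f : C1_smooth f -> smooth f.
Proof. intros H x. apply C1_on_strict_diff; auto. apply convex_full. Qed.

(** Both functionals approximate the increment of [f] from [y] along a short multiple of [h];
    homogeneity removes the scale. The radius [d] is explicit because continuity of the derivative
    needs the estimate for all [y] in one ball. *)
Lemma lin_approx_close f x y e e' l l' d :
  (0 < d /\ forall z w, ns_dist z x < d -> ns_dist w x < d ->
      Rabs (f z - f w - l (ns_add z (ns_opp w))) <= e * ns_dist z w) ->
  bounded_linear l -> lin_approx (fun _ => True) f y e' l' -> ns_dist y x < d ->
  forall h, Rabs (l h - l' h) <= (e + e') * ns_norm h.
Proof.
  intros [Hd H] Hl [Hl' [d' [Hd' H']]] Hy h.
  pose proof (norm_ge0 h) as Hh.
  (* [t] is so small that [y + t h] stays in the ball around [x] and in the one around [y]. *)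
  set (t := Rmin (d - ns_dist y x) d' / (ns_norm h + 1)).
  assert (Hmin : 0 < Rmin (d - ns_dist y x) d') by (apply Rmin_glb_lt; lra).
  assert (Ht : 0 < t) by (apply Rdiv_lt_0_compat; lra).
  assert (Hth : t * ns_norm h < Rmin (d - ns_dist y x) d').
  { replace (Rmin (d - ns_dist y x) d') with (t * (ns_norm h + 1)) by (unfold t; field; lra).
    apply Rmult_lt_compat_l; lra. }
  pose proof (Rmin_l (d - ns_dist y x) d'). pose proof (Rmin_r (d - ns_dist y x) d').
  set (z := ns_add y (ns_scal t h)).
  assert (Hzy : ns_dist z y = t * ns_norm h).
  { unfold z. rewrite dist_add, ns_norm_scal, Rabs_right by lra. reflexivity. }
  assert (B1 := H z y). assert (B2 := H' z y I I).
  rewrite dist_self in B2.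
  pose proof (ns_dist_tri z y x).
  specialize (B1 ltac:(lra) ltac:(lra)). specialize (B2 ltac:(lra) ltac:(lra)).
  replace (ns_add z (ns_opp y)) with (ns_scal t h) in B1, B2 by (unfold z; vec).
  destruct Hl as [_ [ls _]]. destruct Hl' as [_ [ls' _]].
  rewrite ls in B1. rewrite ls' in B2. rewrite Hzy in B1, B2.
  assert (B : Rabs (t * l h - t * l' h) <= t * ((e + e') * ns_norm h)).
  { replace (t * l h - t * l' h) with
      (- (f z - f y - t * l h) + (f z - f y - t * l' h)) by ring.
    eapply Rle_trans; [apply Rabs_triang|]. rewrite Rabs_Ropp. lra. }
  rewrite <- Rmult_minus_distr_l, Rabs_mult, Rabs_right in B by lra.
  apply Rmult_le_reg_l with t; auto.
Qed.

(** Each approximant confines the derivative along [h] to the interval of radius [e * ns_norm h]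
    around [l h]. Any two such intervals meet, so the supremum of the left ends lies in all of them;
    linearity passes to it because [e] is arbitrary. *)
Lemma strict_diff_derivative f x : strict_diff (fun _ => True) f x ->
  exists D, bounded_linear D /\
    forall e l, lin_approx (fun _ => True) f x e l -> forall h, Rabs (D h - l h) <= e * ns_norm h.
Proof.
  intros Hf.
  assert (Hclose : forall e l e' l', lin_approx (fun _ => True) f x e l ->
    lin_approx (fun _ => True) f x e' l' ->
    forall h, l h - e * ns_norm h <= l' h + e' * ns_norm h).
  { intros e l e' l' Hl Hl' h.
    assert (H : Rabs (l h - l' h) <= (e + e') * ns_norm h).
    { assert (Hl0 := Hl). destruct Hl0 as [Hbl [d [Hd H]]].
      apply (lin_approx_close f x x e e' l l' d); auto. rewrite dist_self; auto. }
    apply Rabs_le_inv in H. lra. }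
  assert (Hpt : forall h, exists D, forall e l, lin_approx (fun _ => True) f x e l ->
    Rabs (D - l h) <= e * ns_norm h).
  { intros h.
    destruct (completeness (fun t => exists e l, lin_approx (fun _ => True) f x e l /\
      t = l h - e * ns_norm h)) as [D [Hub Hlub]].
    - destruct (Hf 1 Rlt_0_1) as [l Hl]. exists (l h + 1 * ns_norm h).
      intros t (e & l' & Hl' & ->). apply Hclose; auto.
    - destruct (Hf 1 Rlt_0_1) as [l Hl]. exists (l h - 1 * ns_norm h), 1, l. auto.
    - exists D. intros e l Hl. apply Rabs_le. split.
      + assert (l h - e * ns_norm h <= D); [|lra]. apply Hub. exists e, l; auto.
      + assert (D <= l h + e * ns_norm h); [|lra].
        apply Hlub. intros t (e' & l' & Hl' & ->). apply Hclose; auto. }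
  destruct (choice _ Hpt) as [D HD0].
  assert (HD : forall e l, lin_approx (fun _ => True) f x e l ->
    forall h, Rabs (D h - l h) <= e * ns_norm h) by (intros; apply HD0; auto).
  exists D. split; auto.
  assert (Hsmall : forall a k, 0 <= k -> (forall e, 0 < e -> Rabs a <= e * k) -> a = 0).
  { intros a k Hk Ha. apply NNPP. intros Hne. apply Rabs_pos_lt in Hne.
    specialize (Ha (Rabs a / (2 * (k + 1))) ltac:(apply Rdiv_lt_0_compat; lra)).
    apply (Rmult_le_compat_r (2 * (k + 1))) in Ha; [|lra].
    replace (Rabs a / (2 * (k + 1)) * k * (2 * (k + 1))) with (Rabs a * k) in Ha
      by (field; lra).
    nra. }
  repeat split.
  - intros a b. apply Rminus_diag_uniq.
    apply (Hsmall _ (ns_norm (ns_add a b) + ns_norm a + ns_norm b)).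
    { pose proof (norm_ge0 (ns_add a b)). pose proof (norm_ge0 a). pose proof (norm_ge0 b). lra. }
    intros e He. destruct (Hf e He) as [l Hl].
    pose proof (HD e l Hl (ns_add a b)) as H1. pose proof (HD e l Hl a) as H2.
    pose proof (HD e l Hl b) as H3.
    destruct Hl as [[la _] _]. rewrite la in H1.
    apply Rabs_le_inv in H1. apply Rabs_le_inv in H2. apply Rabs_le_inv in H3.
    apply Rabs_le. lra.
  - intros s a. apply Rminus_diag_uniq.
    apply (Hsmall _ (ns_norm (ns_scal s a) + Rabs s * ns_norm a)).
    { pose proof (norm_ge0 (ns_scal s a)). pose proof (norm_ge0 a). pose proof (Rabs_pos s). nra. }
    intros e He. destruct (Hf e He) as [l Hl].
    pose proof (HD e l Hl (ns_scal s a)) as H1. pose proof (HD e l Hl a) as H2.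
    destruct Hl as [[_ [ls _]] _]. rewrite ls in H1.
    replace (D (ns_scal s a) - s * D a) with
      ((D (ns_scal s a) - s * l a) + - (s * (D a - l a))) by ring.
    eapply Rle_trans; [apply Rabs_triang|]. rewrite Rabs_Ropp, Rabs_mult.
    apply (Rmult_le_compat_l (Rabs s)) in H2; [|apply Rabs_pos]. lra.
  - destruct (Hf 1 Rlt_0_1) as [l Hl]. pose proof (HD _ _ Hl) as H1.
    destruct (bl_bound l (proj1 Hl)) as [M [HM0 HM]].
    exists (M + 1). intros h. specialize (H1 h). specialize (HM h).
    replace (D h) with ((D h - l h) + l h) by ring.
    eapply Rle_trans; [apply Rabs_triang|]. lra.
Qed.

Lemma smooth_C1_smooth f : smooth f -> C1_smooth f.
Proof.
  intros Hf.
  destruct (choice _ (fun x => strict_diff_derivative f x (Hf x))) as [Df HDf].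
  exists Df. split.
  - intros y _. split; [apply HDf|]. intros e He.
    destruct (Hf y (e / 2)) as [l Hl]; [lra|].
    pose proof (proj2 (HDf y) _ _ Hl) as HD.
    destruct Hl as [Hl [d [Hd H]]]. exists d. split; auto. intros h Hh.
    specialize (HD h). specialize (H (ns_add y h) y I I).
    rewrite dist_add, dist_self in H. specialize (H Hh Hd).
    replace (ns_add (ns_add y h) (ns_opp y)) with h in H by vec.
    replace (f (ns_add y h) - f y - Df y h) with
      ((f (ns_add y h) - f y - l h) + - (Df y h - l h)) by ring.
    eapply Rle_trans; [apply Rabs_triang|]. rewrite Rabs_Ropp. lra.
  - intros y _ e He.
    (* Four quarters: one from [Df y] to [l], two from [l] to [l'], one from [l'] to [Df z]. *)
    destruct (Hf y (e / 4)) as [l Hl]; [lra|].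
    pose proof (proj2 (HDf y) _ _ Hl) as HD.
    destruct Hl as [Hl [d [Hd H]]]. exists d. split; auto. intros z _ Hz h.
    destruct (Hf z (e / 4)) as [l' Hl']; [lra|].
    pose proof (proj2 (HDf z) _ _ Hl' h) as HD'. specialize (HD h).
    assert (Hll : Rabs (l h - l' h) <= (e / 4 + e / 4) * ns_norm h).
    { apply (lin_approx_close f y z (e / 4) (e / 4) l l' d); auto. }
    apply Rabs_le_inv in HD. apply Rabs_le_inv in HD'. apply Rabs_le_inv in Hll.
    apply Rabs_le. lra.
Qed.

End StrictDiff.

(** * Lipschitz functions and smooth cutoffs *)

Section Lipschitz.
Context {X : NormedSpace}.
Implicit Types (x y z w : X) (A B E : X -> Prop) (u f F : X -> R).

Lemma lipschitz_sup (J : Type) (j0 : J) (L : R) (g : J -> X -> R) :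
  (forall i, lipschitz L (g i)) ->
  (forall x, exists M, forall i, g i x <= M) ->
  exists F, lipschitz L F /\ (forall i x, g i x <= F x) /\
    forall x M, (forall i, g i x <= M) -> F x <= M.
Proof.
  intros HL Hb.
  assert (Hx : forall x, exists s, (forall i, g i x <= s) /\
    forall M, (forall i, g i x <= M) -> s <= M).
  { intros x. destruct (completeness (fun t => exists i, t = g i x)) as [s [Hs1 Hs2]].
    - destruct (Hb x) as [M HM]. exists M. intros t [i ->]. apply HM.
    - exists (g j0 x), j0. reflexivity.
    - exists s. split.
      + intros i. apply Hs1. exists i. reflexivity.
      + intros M HM. apply Hs2. intros t [i ->]. apply HM. }
  destruct (choice _ Hx) as [F HF].
  exists F. split; [|split].
  - assert (H1 : forall x y, F x <= F y + L * ns_dist x y).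
    { intros x y. apply HF. intros i.
      pose proof (Rabs_le_inv _ _ (HL i x y I I)). pose proof (proj1 (HF y) i). lra. }
    intros x y _ _. apply Rabs_le. pose proof (H1 x y). pose proof (H1 y x).
    rewrite (ns_dist_sym y x) in *. lra.
  - intros i x. apply HF.
  - intros x. apply HF.
Qed.

Lemma lipschitz_dist L a : 0 <= L -> lipschitz L (fun x => - (L * ns_dist x a)).
Proof.
  intros HL x y _ _. apply Rabs_le.
  pose proof (ns_dist_tri x y a). pose proof (ns_dist_tri y x a).
  rewrite (ns_dist_sym y x) in *. nra.
Qed.

Lemma mcshane A L f : 0 <= L -> lipschitz_on A L f ->
  exists F, lipschitz L F /\ forall x, A x -> F x = f x.
Proof.
  intros HL Hf.
  destruct (classic (exists a, A a)) as [[a Ha]|Hno].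
  2: { exists (fun _ => 0). split.
       - intros x y _ _. rewrite Rminus_diag, Rabs_R0.
         apply Rmult_le_pos; [auto|apply dist_ge0].
       - intros x Hx. exfalso. eauto. }
  (* McShane's formula in its supremum form: the largest of the downward cones of slope [L] with
     apex on the graph of [f]. *)
  destruct (lipschitz_sup {b | A b} (exist _ a Ha) L
    (fun b x => f (proj1_sig b) + - (L * ns_dist x (proj1_sig b)))) as [F [HF [Hup Hle]]].
  - intros b x y _ _.
    pose proof (lipschitz_dist L (proj1_sig b) HL x y I I) as H.
    replace (f (proj1_sig b) + - (L * ns_dist x (proj1_sig b)) -
      (f (proj1_sig b) + - (L * ns_dist y (proj1_sig b)))) with
      (- (L * ns_dist x (proj1_sig b)) - - (L * ns_dist y (proj1_sig b))) by ring.
    exact H.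
  - intros x. exists (f a + L * ns_dist x a). intros [b Hb]. simpl.
    pose proof (Rabs_le_inv _ _ (Hf b a Hb Ha)). pose proof (ns_dist_tri b x a).
    rewrite (ns_dist_sym b x) in *. nra.
  - exists F. split; auto. intros x Hx. apply Rle_antisym.
    + apply Hle. intros [b Hb]. simpl.
      pose proof (Rabs_le_inv _ _ (Hf b x Hb Hx)). rewrite (ns_dist_sym b x) in *. lra.
    + pose proof (Hup (exist _ x Hx) x) as H. simpl in H. rewrite dist_self in H. lra.
Qed.

(* The distance to [E], truncated at 1 so that [E] may be empty. *)
Lemma dist_to_set E : exists d, lipschitz 1 d /\ (forall x, 0 <= d x <= 1) /\
  (forall x, E x -> d x = 0) /\
  forall x r, r <= 1 -> d x < r -> exists e, E e /\ ns_dist x e < r.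
Proof.
  destruct (lipschitz_sup (option {b | E b}) None 1
    (fun o x => match o with None => -1
       | Some b => - (1 * ns_dist x (proj1_sig b)) end)) as [F [HF [Hup Hle]]].
  - intros [b|].
    + apply lipschitz_dist. lra.
    + intros x y _ _. rewrite Rminus_diag, Rabs_R0. pose proof (dist_ge0 x y). lra.
  - intros x. exists 0. intros [b|]; [pose proof (dist_ge0 x (proj1_sig b)); lra|lra].
  - exists (fun x => - F x).
    assert (Hneg : forall x, F x <= 0).
    { intros x. apply Hle. intros [b|]; [pose proof (dist_ge0 x (proj1_sig b)); lra|lra]. }
    split; [|split; [|split]].
    + intros x y _ _. replace (- F x - - F y) with (- (F x - F y)) by ring.
      rewrite Rabs_Ropp. apply HF; auto.
    + intros x. pose proof (Hup None x) as H. simpl in H. specialize (Hneg x). lra.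
    + intros x Hx. pose proof (Hup (Some (exist _ x Hx)) x) as H. simpl in H.
      rewrite dist_self in H. specialize (Hneg x). lra.
    + intros x r Hr Hx. apply NNPP. intros Hno.
      assert (F x <= - r); [|lra]. apply Hle. intros [[b Hb]|]; [|lra]. simpl.
      destruct (Rlt_le_dec (ns_dist x b) r); [exfalso; eauto|lra].
Qed.

Lemma dist_to_closed A d : is_closed A ->
  (forall x r, r <= 1 -> d x < r -> exists e, A e /\ ns_dist x e < r) ->
  forall x, ~ A x -> 0 < d x.
Proof.
  intros HA Hd x Hx. destruct (HA x Hx) as [r [Hr H]].
  apply Rlt_le_trans with (Rmin 1 r); [apply Rmin_glb_lt; lra|].
  apply Rnot_lt_le. intros Hlt.
  destruct (Hd x _ (Rmin_l _ _) Hlt) as [e [He Hxe]].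
  pose proof (Rmin_r 1 r). apply (H e); auto. rewrite ns_dist_sym. lra.
Qed.

(** The normalisation [1 <= C] allows unsmoothed Lipschitz bounds to be absorbed into smoothed
    ones. *)
Definition smoothing_constant (C : R) : Prop :=
  1 <= C /\ forall F L, 0 <= L -> lipschitz L F -> forall eta, 0 < eta ->
    exists K, smooth K /\ lipschitz (C * L) K /\ forall x : X, Rabs (F x - K x) < eta.

Lemma lipschitz_on_le A L L' f : L <= L' -> lipschitz_on A L f -> lipschitz_on A L' f.
Proof.
  intros HL Hf x y Hx Hy. eapply Rle_trans; [apply Hf; auto|].
  apply Rmult_le_compat_r; [apply dist_ge0|auto].
Qed.

Lemma property_star_constant : property_star X -> exists C, smoothing_constant C.
Proof.
  intros [C0 H]. exists (Rmax 1 C0). split; [apply Rmax_l|].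
  intros F L HL HF eta Heta.
  destruct (H F (ex_intro _ L (conj HL HF)) eta Heta) as [K [HK [_ [Hclose HKL]]]].
  exists K. split; [apply C1_smooth_smooth; auto|]. split; auto.
  apply (lipschitz_on_le _ (C0 * L)); [|apply HKL; auto].
  apply Rmult_le_compat_r; [auto|apply Rmax_r].
Qed.

Definition sqr_pos (t : R) : R := Rmax 0 t * Rmax 0 t.
(** A C^1 transition from 0 to 1 on the unit interval, composed of squared positive parts so that
    its smoothness is an instance of the chain rule. *)
Definition step (t : R) : R := 1 - sqr_pos (1 - sqr_pos t).

Lemma step_clamp t : exists v, 0 <= v <= 1 /\ step t = 1 - (1 - v * v) * (1 - v * v) /\
  v = Rmin 1 (Rmax 0 t).
Proof.
  exists (Rmin 1 (Rmax 0 t)). split; [|split; [|reflexivity]].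
  - unfold Rmin, Rmax; repeat destruct Rle_dec; lra.
  - unfold step, sqr_pos. unfold Rmin, Rmax; repeat destruct Rle_dec; nra.
Qed.

Lemma step_range t : 0 <= step t <= 1.
Proof. destruct (step_clamp t) as [v [Hv [-> _]]]. assert (0 <= v * v <= 1) by nra. nra. Qed.

Lemma step_0 t : t <= 0 -> step t = 0.
Proof.
  intros Ht. destruct (step_clamp t) as [v [_ [-> ->]]].
  unfold Rmin, Rmax; repeat destruct Rle_dec; try lra.
  replace t with 0 by lra. ring.
Qed.

Lemma step_1 t : 1 <= t -> step t = 1.
Proof.
  intros Ht. destruct (step_clamp t) as [v [_ [-> ->]]].
  unfold Rmin, Rmax; repeat destruct Rle_dec; try lra.
Qed.

Lemma step_lip a b : Rabs (step a - step b) <= 4 * Rabs (a - b).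
Proof.
  destruct (step_clamp a) as [v [Hv [-> Ev]]]. destruct (step_clamp b) as [w [Hw [-> Ew]]].
  apply Rle_trans with (4 * Rabs (v - w)).
  (* For [v] and [w] in the unit interval both factors in front of [v - w] are at most 2, hence the
     constant 4. *)
  - replace (1 - (1 - v * v) * (1 - v * v) - (1 - (1 - w * w) * (1 - w * w)))
      with (((2 - v * v - w * w) * (v + w)) * (v - w)) by ring.
    rewrite Rabs_mult. apply Rmult_le_compat_r; [apply Rabs_pos|].
    assert (0 <= 2 - v * v - w * w <= 2) by nra.
    rewrite Rabs_right by nra. nra.
  - apply Rmult_le_compat_l; [lra|]. subst v w.
    unfold Rmin, Rmax; repeat destruct Rle_dec; unfold Rabs; repeat destruct Rcase_abs; lra.
Qed.

Lemma smooth_const c : smooth (fun _ : X => c).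
Proof. intros x. apply strict_diff_const. Qed.

Lemma smooth_add f F : smooth f -> smooth F -> smooth (fun x : X => f x + F x).
Proof. intros Hf HF x. apply strict_diff_add; auto. Qed.

Lemma smooth_sub f F : smooth f -> smooth F -> smooth (fun x : X => f x - F x).
Proof. intros Hf HF x. apply strict_diff_sub; auto. Qed.

Lemma smooth_mul f F : smooth f -> smooth F -> smooth (fun x : X => f x * F x).
Proof. intros Hf HF x. apply strict_diff_mul; auto. Qed.

Lemma smooth_step f : smooth f -> smooth (fun x : X => step (f x)).
Proof.
  assert (Hsq : forall u, smooth u -> smooth (fun x => sqr_pos (u x))).
  { intros u Hu x. apply (strict_diff_comp sqr_pos); auto. apply strict_diff_sqr_pos. }
  intros Hf. unfold step.
  apply smooth_sub; [apply smooth_const|]. apply (Hsq (fun x => 1 - sqr_pos (f x))).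
  apply smooth_sub; [apply smooth_const|]. apply (Hsq f Hf).
Qed.

(** The slope [M] is finite but otherwise free: the function that the cutoff multiplies is chosen
    afterwards, with an accuracy adapted to [M]. *)
Definition cutoff (phi : X -> R) : Prop :=
  smooth phi /\ (forall x, 0 <= phi x <= 1) /\ exists M, 0 <= M /\ lipschitz M phi.

Lemma cutoff_exists C u s : smoothing_constant C -> lipschitz 1 u -> 0 < s ->
  exists phi, cutoff phi /\ (forall x, 2 * s <= u x -> phi x = 1) /\
    (forall x, u x <= s -> phi x = 0).
Proof.
  intros [HC H] Hu Hs.
  destruct (H u 1 ltac:(lra) Hu (s / 4)) as [K [HK [HKL HKu]]]; [lra|].
  (* Since [K] is within [s / 4] of [u], it is at least [7 s / 4] where [2 s <= u] and at most
     [5 s / 4] where [u <= s]; the affine map sends these two values to 1 and 0. *)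
  exists (fun x => step (2 / s * K x - 5 / 2)). split; [split; [|split]|split].
  - apply smooth_step. apply (smooth_sub (fun x => 2 / s * K x)); [|apply smooth_const].
    apply (smooth_mul (fun _ => 2 / s)); [apply smooth_const|auto].
  - intros x. apply step_range.
  - assert (Hpos : 0 < 2 / s) by (apply Rdiv_lt_0_compat; lra).
    exists (4 * (2 / s * (C * 1))). split; [nra|].
    intros x y _ _. eapply Rle_trans; [apply step_lip|].
    replace (2 / s * K x - 5 / 2 - (2 / s * K y - 5 / 2)) with (2 / s * (K x - K y)) by ring.
    rewrite Rabs_mult, (Rabs_right (2 / s)) by lra.
    rewrite !Rmult_assoc. apply Rmult_le_compat_l; [lra|].
    apply Rmult_le_compat_l; [lra|]. rewrite <- Rmult_assoc. apply HKL; auto.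
  - intros x Hx. apply step_1. pose proof (Rabs_le_inv _ _ (Rlt_le _ _ (HKu x))).
    apply Rmult_le_reg_l with s; [auto|].
    replace (s * (2 / s * K x - 5 / 2)) with (2 * K x - 5 / 2 * s) by (field; lra). lra.
  - intros x Hx. apply step_0. pose proof (Rabs_le_inv _ _ (Rlt_le _ _ (HKu x))).
    apply Rmult_le_reg_l with s; [auto|].
    replace (s * (2 / s * K x - 5 / 2)) with (2 * K x - 5 / 2 * s) by (field; lra). lra.
Qed.

End Lipschitz.
Arguments smoothing_constant : clear implicits.

(** * Blending a sequence of functions along cutoffs *)

Section Blending.
Context {X : NormedSpace}.
Variable phi : nat -> X -> R.
Hypothesis Hphi : forall n, cutoff (phi n).

Fixpoint rest (n : nat) (x : X) : R :=
  match n with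
  | O => 1
  | S n => rest n x * (1 - phi n x)
  end.

(* The weights [rest n * phi n] form a partition of unity wherever some
   [phi n] equals 1. *)
Definition weight (n : nat) (x : X) : R := rest n x * phi n x.

Fixpoint wsum (h : nat -> X -> R) (n : nat) (x : X) : R :=
  match n with
  | O => 0
  | S n => wsum h n x + weight n x * h n x
  end.

Lemma rest_range n x : 0 <= rest n x <= 1.
Proof.
  induction n as [|n IH]; simpl; [lra|].
  destruct (Hphi n) as [_ [H _]]. specialize (H x). nra.
Qed.

Lemma weight_range n x : 0 <= weight n x <= 1.
Proof.
  unfold weight. destruct (Hphi n) as [_ [H _]]. specialize (H x).
  pose proof (rest_range n x). nra.
Qed.

Lemma rest_smooth n : smooth (rest n).
Proof.
  induction n as [|n IH]; simpl; [apply smooth_const|].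
  apply smooth_mul; auto. apply (smooth_sub (fun _ => 1)); [apply smooth_const|apply Hphi].
Qed.

Lemma weight_smooth n : smooth (weight n).
Proof. apply smooth_mul; [apply rest_smooth|apply Hphi]. Qed.

Lemma rest_lip n : exists K, 0 <= K /\ lipschitz K (rest n).
Proof.
  induction n as [|n [K [HK H]]]; simpl.
  - exists 0. split; [lra|]. intros x y _ _. rewrite Rminus_diag, Rabs_R0. lra.
  - destruct (Hphi n) as [_ [Hr [M [HM Hl]]]].
    exists (K + M). split; [lra|]. intros x y _ _.
    specialize (H x y I I). specialize (Hl x y I I).
    pose proof (rest_range n y). pose proof (Hr x).
    replace (rest n x * (1 - phi n x) - rest n y * (1 - phi n y)) with
      ((1 - phi n x) * (rest n x - rest n y) + - (rest n y * (phi n x - phi n y))) by ring.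
    eapply Rle_trans; [apply Rabs_triang|].
    rewrite Rabs_Ropp, !Rabs_mult, (Rabs_right (1 - _)), (Rabs_right (rest n y)) by lra.
    pose proof (Rabs_pos (rest n x - rest n y)). pose proof (Rabs_pos (phi n x - phi n y)). nra.
Qed.

(** The weight is the difference of two consecutive [rest]s. The bound is made strictly positive
    because accuracies are later divided by it. *)
Lemma weight_lip : exists M : nat -> R, forall n, 0 < M n /\ lipschitz (M n) (weight n).
Proof.
  assert (H : forall n, exists M, 0 < M /\ lipschitz M (weight n)).
  { intros n. destruct (rest_lip n) as [K [HK H]]. destruct (rest_lip (S n)) as [K' [HK' H']].
    exists (K + K' + 1). split; [lra|]. intros x y _ _.
    specialize (H x y I I). specialize (H' x y I I). simpl in H'.
    replace (weight n x - weight n y) with ((rest n x - rest n y) +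
      - (rest n x * (1 - phi n x) - rest n y * (1 - phi n y))) by (unfold weight; ring).
    eapply Rle_trans; [apply Rabs_triang|]. rewrite Rabs_Ropp.
    pose proof (dist_ge0 x y). lra. }
  exact (choice _ H).
Qed.

(** A whole neighbourhood is asked for, so that the blend is one fixed finite sum near [x]. *)
Definition covered (x : X) : Prop :=
  exists n d, 0 < d /\ forall z, ns_dist z x < d -> phi n z = 1.

Lemma rest_0_wsum h m n x : rest m x = 0 -> (m <= n)%nat -> rest n x = 0 /\ wsum h n x = wsum h m x.
Proof.
  intros H0 Hmn. induction Hmn as [|n Hmn [IH1 IH2]]; auto. simpl.
  unfold weight. rewrite IH1, IH2. split; ring.
Qed.

(** The infinite sum of the [weight n * h n], without convergence: once [rest n x = 0], all later
    weights vanish at [x] and the partial sum is final. Points where no [rest] vanishes are left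
    unconstrained. *)
Definition is_blend (h : nat -> X -> R) (g : X -> R) : Prop :=
  forall x n, rest n x = 0 -> g x = wsum h n x.

Lemma blend_exists h : exists g, is_blend h g.
Proof.
  assert (H : forall x, exists t, forall n, rest n x = 0 -> t = wsum h n x).
  { intros x. destruct (classic (exists n, rest n x = 0)) as [[m Hm]|Hno].
    - exists (wsum h m x). intros n Hn. destruct (Nat.le_ge_cases m n) as [Hle|Hle].
      + symmetry. apply (rest_0_wsum h m n x); auto.
      + apply (rest_0_wsum h n m x); auto.
    - exists 0. intros n Hn. exfalso. eauto. }
  exact (choice _ H).
Qed.

Lemma covered_rest x : covered x ->
  exists n d, 0 < d /\ forall z, ns_dist z x < d -> rest n z = 0.
Proof.
  intros [n [d [Hd H]]]. exists (S n), d. split; auto.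
  intros z Hz. simpl. rewrite H by auto. ring.
Qed.

Lemma blend_strict_diff h g x : is_blend h g -> covered x ->
  (forall m, (exists d, 0 < d /\ forall z, ns_dist z x < d -> phi m z = 0) \/
     strict_diff (fun _ => True) (h m) x) ->
  strict_diff (fun _ => True) g x.
Proof.
  intros Hg Hc Hh. destruct (covered_rest x Hc) as [n [d [Hd Hrest]]].
  apply (strict_diff_local _ (fun _ => True) (wsum h n)).
  { exists d. split; auto. intros z _ Hz. split; auto. symmetry. apply Hg. auto. }
  clear Hrest. induction n as [|n IH]; simpl; [apply strict_diff_const|].
  apply strict_diff_add; auto. destruct (Hh n) as [[e [He Hzero]]|Hsd].
  - apply (strict_diff_local _ (fun _ => True) (fun _ => 0)); [|apply strict_diff_const].
    exists e. split; auto. intros z _ Hz. split; auto. unfold weight.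
    rewrite Hzero by auto. ring.
  - apply strict_diff_mul; auto. apply weight_smooth.
Qed.

Section Estimate.
Variables (h : nat -> X -> R) (g : X -> R) (M eta : nat -> R) (eps : R).
Hypothesis Hg : is_blend h g.
Hypothesis HM : forall n, lipschitz (M n) (weight n).
Hypothesis Heps0 : 0 <= eps.
Hypothesis Heta : forall n, M n * eta n <= eps * (/ 2) ^ (S n).
Variables (A : X -> Prop) (lam F : X -> R) (x : X) (c : R).
Hypothesis Hh : forall m,
  (exists d, 0 < d /\ forall z, A z -> ns_dist z x < d -> phi m z = 0) \/
  (near_lip A c (fun z => h m z - lam z) x /\
   exists d, 0 < d /\ forall z, A z -> ns_dist z x < d -> Rabs (h m z - F z) <= eta m).

(* As the weights sum to 1, their variation only sees the differences
   [h m - F]; this is what [rest n] times [F] accounts for. *)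
Lemma wsum_estimate n : exists d, 0 < d /\
  forall z w, A z -> A w -> ns_dist z x < d -> ns_dist w x < d ->
  Rabs ((wsum h n z - (1 - rest n z) * lam z) - (wsum h n w - (1 - rest n w) * lam w)
        + (rest n z - rest n w) * (F w - lam w))
  <= (c * (1 - rest n z) + eps * (1 - (/ 2) ^ n)) * ns_dist z w.
Proof.
  induction n as [|n [d1 [Hd1 IH]]].
  { exists 1. split; [lra|]. intros z w _ _ _ _. simpl.
    match goal with |- Rabs ?a <= ?b => replace a with 0 by ring; replace b with 0 by ring end.
    rewrite Rabs_R0. lra. }
  (* A discrete product rule for the step from [n] to [S n]: the variation of [h n - lam] under a
     fixed weight costs [c] times that weight, and the variation of the weight multiplies [h n - F],
     costing at most [M n * eta n]. *)
  assert (Hinc : exists d2, 0 < d2 /\ forall z w, A z -> A w -> ns_dist z x < d2 ->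
    ns_dist w x < d2 ->
    Rabs (weight n z * ((h n z - lam z) - (h n w - lam w)) +
          (weight n z - weight n w) * (h n w - F w))
    <= (c * weight n z + eps * (/ 2) ^ (S n)) * ns_dist z w).
  { assert (Heps : 0 <= eps * (/ 2) ^ (S n)).
    { apply Rmult_le_pos; [lra|]. apply pow_le. lra. }
    destruct (Hh n) as [[d2 [Hd2 Hzero]]|[[d2 [Hd2 H1]] [d3 [Hd3 H2]]]].
    - exists d2. split; auto. intros z w Az Aw Hz Hw. unfold weight.
      rewrite !Hzero by auto.
      match goal with |- Rabs ?a <= _ => replace a with 0 by ring end.
      rewrite Rabs_R0. apply Rmult_le_pos; [lra|apply dist_ge0].
    - exists (Rmin d2 d3). split; [apply Rmin_glb_lt; auto|]. intros z w Az Aw Hz Hw.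
      pose proof (Rmin_l d2 d3). pose proof (Rmin_r d2 d3).
      specialize (H1 z w Az Aw ltac:(lra) ltac:(lra)).
      specialize (H2 w Aw ltac:(lra)).
      eapply Rle_trans; [apply Rabs_triang|]. rewrite !Rabs_mult.
      pose proof (weight_range n z). rewrite (Rabs_right (weight n z)) by lra.
      apply (Rmult_le_compat_l (weight n z)) in H1; [|lra].
      assert (Rabs (weight n z - weight n w) * Rabs (h n w - F w)
              <= (M n * ns_dist z w) * eta n).
      { apply Rmult_le_compat; auto using Rabs_pos. apply HM; auto. }
      pose proof (dist_ge0 z w) as Hzw.
      pose proof (Rmult_le_compat_r (ns_dist z w) _ _ Hzw (Heta n)). lra. }
  destruct Hinc as [d2 [Hd2 Hinc]].
  exists (Rmin d1 d2). split; [apply Rmin_glb_lt; auto|]. intros z w Az Aw Hz Hw.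
  pose proof (Rmin_l d1 d2). pose proof (Rmin_r d1 d2).
  specialize (IH z w Az Aw ltac:(lra) ltac:(lra)).
  specialize (Hinc z w Az Aw ltac:(lra) ltac:(lra)).
  assert (Hrest : forall y, rest (S n) y = rest n y - weight n y)
    by (intros y; unfold weight; simpl; ring).
  rewrite !Hrest. change (wsum h (S n) z) with (wsum h n z + weight n z * h n z).
  change (wsum h (S n) w) with (wsum h n w + weight n w * h n w).
  match type of IH with Rabs ?a <= _ => match type of Hinc with Rabs ?b <= _ =>
    match goal with |- Rabs ?t <= _ => replace t with (a + b) by ring end end end.
  eapply Rle_trans; [apply Rabs_triang|].
  eapply Rle_trans; [apply Rplus_le_compat; [apply IH|apply Hinc]|].
  apply Req_le. simpl. field.
Qed.

(** [F] is the function that the pieces are close to and [lam] the one subtracted from the blend.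
    With [lam = F] the conclusion measures the error of the blend, with [lam = 0] the Lipschitz
    constant of the blend itself. *)
Lemma blend_near_lip : covered x -> near_lip A (c + eps) (fun z => g z - lam z) x.
Proof.
  intros Hcov. destruct (covered_rest x Hcov) as [n [d1 [Hd1 Hrest]]].
  destruct (wsum_estimate n) as [d2 [Hd2 H]].
  exists (Rmin d1 d2). split; [apply Rmin_glb_lt; auto|]. intros z w Az Aw Hz Hw.
  pose proof (Rmin_l d1 d2). pose proof (Rmin_r d1 d2).
  specialize (H z w Az Aw ltac:(lra) ltac:(lra)).
  rewrite !Hrest in H by lra.
  rewrite (Hg z n), (Hg w n) by (apply Hrest; lra).
  match type of H with Rabs ?a <= _ => match goal with |- Rabs ?t <= _ =>
    replace t with a by ring end end.
  eapply Rle_trans; [apply H|]. apply Rmult_le_compat_r; [apply dist_ge0|].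
  assert (0 <= (/ 2) ^ n) by (apply pow_le; lra). nra.
Qed.

End Estimate.
End Blending.

(** * Well-orders and Stone's discrete families *)

Lemma zorn (T : Type) (t0 : T) (R : T -> T -> Prop) :
  (forall t, R t t) -> (forall r s t, R r s -> R s t -> R r t) ->
  (forall A : T -> Prop, (forall s t, A s -> A t -> R s t \/ R t s) ->
     exists t, forall s, A s -> R s t) ->
  exists t, forall s, R t s -> R s t.
Proof.
  intros Hrefl Htrans Hchain.
  destruct (@classical_sets.ZL_preorder T t0 (fun a b => boolp.asbool (R a b))) as [t Ht].
  - intros t. apply boolp.asboolT, Hrefl.
  - intros r s t H1 H2. apply boolp.asboolW in H1. apply boolp.asboolW in H2.
    apply boolp.asboolT. eauto.
  - intros A HA. destruct (Hchain A) as [t Ht].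
    + intros s t Hs Ht. destruct (HA s t Hs Ht) as [H|H]; apply boolp.asboolW in H; auto.
    + exists t. intros s Hs. apply boolp.asboolT; auto.
  - exists t. intros s Hs. apply boolp.asboolW. apply Ht. apply boolp.asboolT; auto.
Qed.

Lemma well_order_exists (T : Type) : exists lt : T -> T -> Prop,
  (forall P : T -> Prop, (exists x, P x) -> exists m, P m /\ forall b, lt b m -> ~ P b) /\
  (forall a b, a <> b -> lt a b \/ lt b a).
Proof.
  (* The well-ordering principle is available for types with decidable equality; [boolp.Peq]
     transfers it to every type. *)
  revert T. pose proof boolp.Peq as HPeq. unfold boolp.canonical_of in HPeq. apply HPeq.
  intros T. destruct (wochoice.well_ordering_principle T) as [R HR].
  assert (Hmin : forall P : eqtype.Equality.sort T -> Prop, (exists x, P x) ->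
    exists m, (P m /\ forall b, P b -> R m b = true) /\
      forall m', P m' /\ (forall b, P b -> R m' b = true) -> m = m').
  { intros P [x Hx]. destruct (HR (fun x => boolp.asbool (P x))) as [m [[Pm Hm] Huniq]].
    - exists x. apply boolp.asboolT. exact Hx.
    - exists m. split; [split|].
      + apply boolp.asboolW. exact Pm.
      + intros b Hb. apply Hm. apply boolp.asboolT. exact Hb.
      + intros m' [Pm' Hm']. apply Huniq. split.
        * apply boolp.asboolT. exact Pm'.
        * intros b Hb. apply Hm'. apply boolp.asboolW. exact Hb. }
  assert (Hrefl : forall a, R a a = true).
  { intros a. destruct (Hmin (fun x => x = a)) as [m [[-> Hm] _]]; eauto. }
  (* The strict order is the negation of the reversed order. Comparability of distinct points rests
     on antisymmetry, which is uniqueness of the minimum of a pair. *)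
  exists (fun a b => R b a <> true). split.
  - intros P HP. destruct (Hmin P HP) as [m [[Pm Hm] _]]. exists m. split; auto.
  - intros a b Hab. apply NNPP. intros Hno. apply Hab.
    destruct (R b a) eqn:E1; [|exfalso; apply Hno; left; discriminate].
    destruct (R a b) eqn:E2; [|exfalso; apply Hno; right; discriminate].
    destruct (Hmin (fun x => x = a \/ x = b)) as [m [_ Hm]]; [eauto|].
    rewrite <- (Hm a), <- (Hm b); auto.
    + split; auto. intros c [->| ->]; auto.
    + split; auto. intros c [->| ->]; auto.
Qed.

Lemma half_pow_pos n : 0 < (/ 2) ^ n.
Proof. apply pow_lt. lra. Qed.

Lemma half_pow_small r : 0 < r -> exists n, (/ 2) ^ n < r.
Proof.
  intros Hr. destruct (pow_lt_1_zero (/ 2)) with (y := r) as [N HN]; auto.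
  - rewrite Rabs_right; lra.
  - exists N. specialize (HN N (le_n N)). rewrite Rabs_right in HN; auto.
    apply Rle_ge, Rlt_le, half_pow_pos.
Qed.

(** Call [r b - ns_dist x b] the depth of [x] in the ball of [b]. Members of [E n a] have depth more
    than [2^-n] in their own ball and at most half of that in every earlier one. Depth is
    1-Lipschitz, so members with different centres are at least [2^-(n+1)] apart. A point [y] is
    caught by the first ball containing it, at a level finer than its depth there. *)
Lemma stone_families {X : NormedSpace} (Y : X -> Prop) (r : X -> R) :
  (forall a, Y a -> 0 < r a) ->
  exists E : nat -> X -> X -> Prop,
    (forall n a x, E n a x -> Y a /\ ns_dist x a < r a - (/ 2) ^ n) /\
    (forall n a b x y, E n a x -> E n b y -> a <> b -> (/ 2) ^ (S n) <= ns_dist x y) /\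
    (forall y, Y y -> exists n a, E n a y).
Proof.
  intros Hr. destruct (well_order_exists X) as [lt [Hmin Htot]].
  exists (fun n a x => Y a /\ ns_dist x a < r a - (/ 2) ^ n /\
    forall b, Y b -> lt b a -> r b - ns_dist x b <= (/ 2) ^ (S n)).
  split; [|split].
  - intros n a x [H1 [H2 _]]. auto.
  - intros n a b x y [Ya [Ha Ha']] [Yb [Hb Hb']] Hab.
    assert (Hpow : (/ 2) ^ n = 2 * (/ 2) ^ (S n)) by (simpl; field).
    destruct (Htot a b Hab) as [Hlt|Hlt].
    + specialize (Hb' a Ya Hlt). pose proof (ns_dist_tri y x a).
      rewrite (ns_dist_sym y x) in *. lra.
    + specialize (Ha' b Yb Hlt). pose proof (ns_dist_tri x y b). lra.
  - intros y Hy.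
    destruct (Hmin (fun a => Y a /\ ns_dist y a < r a)) as [a [[Ya Ha] Hfirst]].
    { exists y. rewrite dist_self. auto. }
    destruct (half_pow_small (r a - ns_dist y a)) as [n Hn]; [lra|].
    exists n, a. split; [auto|split; [lra|]]. intros b Yb Hb.
    pose proof (half_pow_pos (S n)).
    apply Rnot_lt_le. intros Hlt. apply (Hfirst b Hb). split; auto. lra.
Qed.

(** * Hahn-Banach extension *)

Lemma inf_exists (E : R -> Prop) m : (exists t, E t) -> (forall t, E t -> m <= t) ->
  exists i, (forall t, E t -> i <= t) /\ forall b, (forall t, E t -> b <= t) -> b <= i.
Proof.
  intros [t0 Ht0] Hm.
  destruct (completeness (fun t => E (- t))) as [s [Hs1 Hs2]].
  - exists (- m). intros t Ht. specialize (Hm _ Ht). lra.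
  - exists (- t0). rewrite Ropp_involutive. auto.
  - exists (- s). split.
    + intros t Ht. assert (H : E (- - t)) by (rewrite Ropp_involutive; auto).
      specialize (Hs1 _ H). lra.
    + intros b Hb. assert (s <= - b); [|lra]. apply Hs2. intros t Ht.
      specialize (Hb _ Ht). lra.
Qed.

Section HahnBanach.
Context {X : NormedSpace}.
Implicit Types (p q : X -> R) (x y : X).

Definition sublinear p : Prop :=
  (forall x y, p (ns_add x y) <= p x + p y) /\
  (forall t x, 0 <= t -> p (ns_scal t x) <= t * p x).

Lemma sublinear_scal p t x : sublinear p -> 0 <= t -> p (ns_scal t x) = t * p x.
Proof.
  intros [Hadd Hscal] Ht. apply Rle_antisym; [auto|].
  destruct (Req_dec t 0) as [->|Hne].
  - pose proof (Hadd (ns_scal 0 x) (ns_scal 0 x)) as H.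
    replace (ns_add (ns_scal 0 x) (ns_scal 0 x)) with (ns_scal 0 x) in H by vec. lra.
  - pose proof (Hscal (/ t) (ns_scal t x)) as H.
    replace (ns_scal (/ t) (ns_scal t x)) with x in H by (vec; auto).
    assert (Hit : 0 < / t) by (apply Rinv_0_lt_compat; lra).
    specialize (H (Rlt_le _ _ Hit)).
    apply (Rmult_le_compat_l t) in H; auto.
    rewrite <- Rmult_assoc, Rinv_r, Rmult_1_l in H; auto.
Qed.

Lemma sublinear_neg p x : sublinear p -> - p (ns_opp x) <= p x.
Proof.
  intros Hp. assert (H := Hp). destruct H as [Hadd _]. pose proof (Hadd x (ns_opp x)) as H.
  replace (ns_add x (ns_opp x)) with (ns_scal 0 x) in H by vec.
  rewrite sublinear_scal in H by (auto; lra). lra.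
Qed.

(** The members [g j] need not be sublinear: closure of the family under sums and nonnegative
    multiples suffices. This covers infima of chains, the minimality test and the inf-convolution
    used below. *)
Lemma sublinear_inf (J : Type) (j0 : J) (g : J -> X -> R) (low : X -> R) :
  (forall j x, low x <= g j x) ->
  (forall i j x y, exists k, g k (ns_add x y) <= g i x + g j y) ->
  (forall j t x, 0 <= t -> exists k, g k (ns_scal t x) <= t * g j x) ->
  exists q, sublinear q /\ (forall j x, q x <= g j x) /\
    forall x b, (forall j, b <= g j x) -> b <= q x.
Proof.
  intros Hlow Hdir Hscal.
  assert (Hx : forall x, exists i, (forall j, i <= g j x) /\
    forall b, (forall j, b <= g j x) -> b <= i).
  { intros x. destruct (inf_exists (fun t => exists j, t = g j x) (low x)) as [i [H1 H2]].
    - exists (g j0 x), j0. auto.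
    - intros t [j ->]. apply Hlow.
    - exists i. split; [intros j; apply H1; eauto|].
      intros b Hb. apply H2. intros t [j ->]. auto. }
  destruct (choice _ Hx) as [q Hq].
  exists q. split; [split|split].
  - intros x y.
    assert (H : q (ns_add x y) - q y <= q x); [|lra].
    apply (Hq x). intros i. assert (H : q (ns_add x y) - g i x <= q y); [|lra].
    apply (Hq y). intros j. destruct (Hdir i j x y) as [k Hk].
    pose proof (proj1 (Hq (ns_add x y)) k). lra.
  - intros t x Ht.
    assert (H : forall j, q (ns_scal t x) <= t * g j x).
    { intros j. destruct (Hscal j t x Ht) as [k Hk].
      pose proof (proj1 (Hq (ns_scal t x)) k). lra. }
    destruct (Req_dec t 0) as [->|Hne].
    + specialize (H j0). lra.
    + apply Rmult_le_reg_l with (/ t); [apply Rinv_0_lt_compat; lra|].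
      rewrite <- Rmult_assoc, Rinv_l, Rmult_1_l by auto.
      apply (Hq x). intros j. specialize (H j).
      apply Rmult_le_reg_l with t; [lra|].
      rewrite <- Rmult_assoc, Rinv_r, Rmult_1_l by auto. exact H.
  - intros j x. apply Hq.
  - intros x. apply Hq.
Qed.

Lemma sublinear_minimal p : sublinear p -> exists q, sublinear q /\
  (forall x, q x <= p x) /\
  forall q', sublinear q' -> (forall x, q' x <= q x) -> forall x, q x <= q' x.
Proof.
  intros Hp.
  set (T := {q | sublinear q /\ forall x, q x <= p x}).
  set (p0 := exist _ p (conj Hp (fun x => Rle_refl (p x))) : T).
  (* The order is reversed, so that a maximal element is a minimal sublinear functional. *)
  destruct (zorn T p0 (fun s r => forall x, proj1_sig r x <= proj1_sig s x)) as [[q [Hq Hqp]] Hmin].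
  - intros t x. lra.
  - intros r s t H1 H2 x. specialize (H1 x). specialize (H2 x). lra.
  - intros A HA. destruct (classic (exists a, A a)) as [[a Ha]|Hno].
    2: { exists p0. intros s Hs. exfalso. eauto. }
    destruct (sublinear_inf {r : T | A r} (exist _ a Ha)
      (fun r => proj1_sig (proj1_sig r)) (fun x => - p (ns_opp x))) as [m [Hm [Hlow _]]].
    + intros [[r [Hr Hrp]] Ar] x. simpl. pose proof (sublinear_neg r x Hr).
      pose proof (Hrp (ns_opp x)). lra.
    + intros [[r [Hr Hrp]] Ar] [[s [Hs Hsp]] As] x y.
      destruct (HA _ _ Ar As) as [H|H]; simpl in H.
      * exists (exist _ _ As). simpl. eapply Rle_trans; [apply Hs|]. specialize (H x). lra.
      * exists (exist _ _ Ar). simpl. eapply Rle_trans; [apply Hr|]. specialize (H y). lra.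
    + intros [[r [Hr Hrp]] Ar] t x Ht. exists (exist _ _ Ar). simpl. apply Hr; auto.
    + assert (Hmp : forall x, m x <= p x).
      { intros x. pose proof (Hlow (exist _ _ Ha) x) as H.
        pose proof (proj2 (proj2_sig a) x). simpl in *. lra. }
      exists (exist _ m (conj Hm Hmp)). intros s As x. apply (Hlow (exist _ s As)).
  - exists q. split; [auto|split; [auto|]]. intros q' Hq' Hle x.
    assert (Hq'p : forall x, q' x <= p x).
    { intros z. eapply Rle_trans; eauto. }
    apply (Hmin (exist _ q' (conj Hq' Hq'p))). exact Hle.
Qed.

(** No subspace appears: the functional to be extended is encoded in [p]. Minimal sublinear
    functionals are additive, and additivity gives the negative multiples. *)
Lemma hahn_banach p : sublinear p -> exists q,
  (forall x y, q (ns_add x y) = q x + q y) /\ (forall t x, q (ns_scal t x) = t * q x) /\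
  forall x, q x <= p x.
Proof.
  intros Hp. destruct (sublinear_minimal p Hp) as [q [Hq [Hqp Hmin]]].
  assert (Hadd : forall x y, q (ns_add x y) = q x + q y).
  { intros x y. apply Rle_antisym; [apply Hq|].
    (* By minimality, [q] is not decreased by [x |-> inf_t (q (x + t y) - t q y)]. *)
    destruct (sublinear_inf {t | 0 <= t} (exist _ 0 (Rle_refl 0))
      (fun t x => q (ns_add x (ns_scal (proj1_sig t) y)) - proj1_sig t * q y)
      (fun x => - q (ns_opp x))) as [qy [Hqy [Hle _]]].
    - intros [t Ht] z. simpl.
      pose proof (proj1 Hq (ns_add z (ns_scal t y)) (ns_opp z)) as H.
      replace (ns_add (ns_add z (ns_scal t y)) (ns_opp z)) with (ns_scal t y) in H by vec.
      rewrite sublinear_scal in H by auto. lra.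
    - intros [s Hs] [t Ht] z w. exists (exist _ (s + t) (Rplus_le_le_0_compat _ _ Hs Ht)). simpl.
      pose proof (proj1 Hq (ns_add z (ns_scal s y)) (ns_add w (ns_scal t y))) as H.
      replace (ns_add (ns_add z (ns_scal s y)) (ns_add w (ns_scal t y)))
        with (ns_add (ns_add z w) (ns_scal (s + t) y)) in H by vec. lra.
    - intros [s Hs] t z Ht. exists (exist _ (t * s) (Rmult_le_pos _ _ Ht Hs)). simpl.
      replace (ns_add (ns_scal t z) (ns_scal (t * s) y))
        with (ns_scal t (ns_add z (ns_scal s y))) by vec.
      rewrite sublinear_scal by auto. lra.
    - assert (H1 : q x <= qy x).
      { apply Hmin; auto. intros z. specialize (Hle (exist _ 0 (Rle_refl 0)) z). simpl in Hle.
        replace (ns_add z (ns_scal 0 y)) with z in Hle by vec. lra. }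
      specialize (Hle (exist _ 1 Rle_0_1) x). simpl in Hle.
      rewrite ns_scal_one in Hle. lra. }
  exists q. split; [auto|split; [|auto]]. intros t x.
  destruct (Rle_lt_dec 0 t) as [Ht|Ht]; [apply sublinear_scal; auto|].
  pose proof (Hadd (ns_scal t x) (ns_scal (- t) x)) as H.
  replace (ns_add (ns_scal t x) (ns_scal (- t) x)) with (ns_scal 0 x) in H by vec.
  rewrite (sublinear_scal q 0), (sublinear_scal q (- t)) in H by (auto; lra). lra.
Qed.

(** On all of [X] the norm of [l] may be large; only its size on [Y - Y] is controlled. The
    sublinear infimum of [L * ns_dist x v + l v] over the span lies below [L * ns_norm x] (take
    [v = 0]) and below [l] on [Y - Y] (take [v = x]). Since [Y - Y] is symmetric, being dominated by
    [l] there means agreeing with it. *)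
Lemma extend_from_convex (Y : X -> Prop) (a : X) (l : X -> R) (L : R) :
  is_convex Y -> Y a -> bounded_linear l -> 0 <= L ->
  (forall z w, Y z -> Y w -> Rabs (l (ns_add z (ns_opp w))) <= L * ns_dist z w) ->
  exists xi, bounded_linear xi /\ (forall x, Rabs (xi x) <= L * ns_norm x) /\
    forall z w, Y z -> Y w -> xi (ns_add z (ns_opp w)) = l (ns_add z (ns_opp w)).
Proof.
  intros HY Ha Hl HL HlL. assert (H := Hl). destruct H as [la [ls _]].
  (* As [Y] is convex, this cone is already the linear span of [Y - Y]. *)
  set (V := fun v => exists s z w, 0 <= s /\ Y z /\ Y w /\ v = ns_scal s (ns_add z (ns_opp w))).
  assert (HV : forall v, V v -> Rabs (l v) <= L * ns_norm v).
  { intros v (s & z & w & Hs & Hz & Hw & ->).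
    rewrite ls, Rabs_mult, ns_norm_scal. pose proof (HlL z w Hz Hw) as H.
    unfold ns_dist in H. apply (Rmult_le_compat_l (Rabs s)) in H; [|apply Rabs_pos]. lra. }
  assert (Vadd : forall v v', V v -> V v' -> V (ns_add v v')).
  { intros v v' (s & z & w & Hs & Hz & Hw & ->) (s' & z' & w' & Hs' & Hz' & Hw' & ->).
    destruct (Req_dec (s + s') 0) as [H0|Hne].
    - exists 0, a, a. repeat split; auto; [lra|].
      replace s with 0 by lra. replace s' with 0 by lra. vec.
    (* The two differences are averaged with weights proportional to [s] and [s'], which keeps both
       end points in [Y]. *)
    - exists (s + s'),
        (ns_add (ns_scal (s / (s + s')) z) (ns_scal (1 - s / (s + s')) z')),
        (ns_add (ns_scal (s / (s + s')) w) (ns_scal (1 - s / (s + s')) w')).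
      assert (0 <= s / (s + s') <= 1).
      { split; [apply Rmult_le_pos; [auto|apply Rlt_le, Rinv_0_lt_compat; lra]|].
        apply Rmult_le_reg_r with (s + s'); [lra|].
        unfold Rdiv. rewrite Rmult_assoc, Rinv_l by auto. lra. }
      repeat split; try lra; try (apply HY; auto). vec; auto. }
  assert (Vscal : forall t v, 0 <= t -> V v -> V (ns_scal t v)).
  { intros t v Ht (s & z & w & Hs & Hz & Hw & ->). exists (t * s), z, w.
    repeat split; auto; [apply Rmult_le_pos; auto|]. apply ns_scal_assoc. }
  assert (V0 : V ns_zero).
  { exists 0, a, a. repeat split; auto; [lra|vec]. }
  destruct (sublinear_inf {v | V v} (exist _ _ V0)
    (fun v x => L * ns_dist x (proj1_sig v) + l (proj1_sig v))
    (fun x => - (L * ns_norm x))) as [p [Hp [Hle _]]].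
  - intros [v Hv] x. simpl. pose proof (Rabs_le_inv _ _ (HV v Hv)).
    pose proof (ns_norm_triangle X x (ns_add v (ns_opp x))) as Htri.
    replace (ns_add x (ns_add v (ns_opp x))) with v in Htri by vec.
    fold (ns_dist v x) in Htri. rewrite ns_dist_sym in Htri. nra.
  - intros [v Hv] [v' Hv'] x y. exists (exist _ _ (Vadd v v' Hv Hv')). simpl.
    rewrite la. unfold ns_dist.
    pose proof (ns_norm_triangle X (ns_add x (ns_opp v)) (ns_add y (ns_opp v'))) as Htri.
    replace (ns_add (ns_add x y) (ns_opp (ns_add v v')))
      with (ns_add (ns_add x (ns_opp v)) (ns_add y (ns_opp v'))) by vec. nra.
  - intros [v Hv] t x Ht. exists (exist _ _ (Vscal t v Ht Hv)). simpl.
    rewrite ls. unfold ns_dist.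
    replace (ns_add (ns_scal t x) (ns_opp (ns_scal t v)))
      with (ns_scal t (ns_add x (ns_opp v))) by vec.
    rewrite ns_norm_scal, Rabs_right by lra. lra.
  - destruct (hahn_banach p Hp) as [xi [xa [xs Hxi]]].
    assert (Hxn : forall x, xi x <= L * ns_norm x).
    { intros x. eapply Rle_trans; [apply Hxi|]. specialize (Hle (exist _ _ V0) x). simpl in Hle.
      assert (l ns_zero = 0) by (rewrite <- (scal_zero_l ns_zero), ls; ring).
      replace (ns_dist x ns_zero) with (ns_norm x) in Hle by (unfold ns_dist; f_equal; vec). lra. }
    assert (Hxneg : forall x, xi (ns_opp x) = - xi x).
    { intros x. rewrite opp_scal, xs. ring. }
    assert (Hxabs : forall x, Rabs (xi x) <= L * ns_norm x).
    { intros x. apply Rabs_le. pose proof (Hxn x). pose proof (Hxn (ns_opp x)) as Hn.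
      rewrite Hxneg, norm_opp in Hn. lra. }
    assert (Hxl : forall z w, Y z -> Y w -> xi (ns_add z (ns_opp w)) <= l (ns_add z (ns_opp w))).
    { intros z w Hz Hw. assert (Vzw : V (ns_add z (ns_opp w))).
      { exists 1, z, w. repeat split; auto; [lra|]. symmetry. apply ns_scal_one. }
      eapply Rle_trans; [apply Hxi|]. specialize (Hle (exist _ _ Vzw) (ns_add z (ns_opp w))).
      simpl in Hle. rewrite dist_self in Hle. lra. }
    exists xi. split; [split; [auto|split; [auto|exists L; auto]]|split; [auto|]].
    intros z w Hz Hw. apply Rle_antisym; [auto|].
    specialize (Hxl w z Hw Hz).
    assert (Hxi' : bounded_linear xi) by (split; [auto|split; [auto|exists L; auto]]).
    rewrite (bl_sub xi), (bl_sub l) in Hxl by auto.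
    rewrite (bl_sub xi), (bl_sub l) by auto. lra.
Qed.

End HahnBanach.

(** * Approximation near a convex set *)

Section NearApproximation.
Context {X : NormedSpace}.
Variable C : R.
Hypothesis HC : smoothing_constant X C.

Lemma weight_budget (phi : nat -> X -> R) e : (forall n, cutoff (phi n)) -> 0 < e ->
  exists M eta : nat -> R, forall n, lipschitz (M n) (weight phi n) /\ 0 < eta n /\
    M n * eta n <= e * (/ 2) ^ (S n).
Proof.
  intros Hphi He. destruct (weight_lip phi Hphi) as [M HM].
  exists M, (fun n => e * (/ 2) ^ (S n) / M n). intros n. destruct (HM n) as [Hpos Hlip].
  split; [auto|split].
  - apply Rdiv_lt_0_compat; auto. apply Rmult_lt_0_compat; auto. apply half_pow_pos.
  - apply Req_le. field. lra.
Qed.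

(** [G] extends the remainder [f - xi], [K] smooths [G], and [h = xi + K]. On the piece of [Y] in
    question [h - f = K - G], whose slope is at most [C * e + e] whatever the accuracy [eta]. *)
Lemma affine_piece (Y : X -> Prop) f e (xi : X -> R) a r eta :
  0 < e -> 0 < eta -> bounded_linear xi ->
  (forall z w, Y z -> Y w -> ns_dist z a < r -> ns_dist w a < r ->
     Rabs (f z - f w - xi (ns_add z (ns_opp w))) <= e * ns_dist z w) ->
  exists h, smooth h /\
    (forall z w, Y z -> Y w -> ns_dist z a < r -> ns_dist w a < r ->
       Rabs ((h z - f z) - (h w - f w)) <= (C * e + e) * ns_dist z w) /\
    (forall z, Y z -> ns_dist z a < r -> Rabs (h z - f z) < eta) /\
    forall L, (forall x, Rabs (xi x) <= L * ns_norm x) -> lipschitz (L + C * e) h.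
Proof.
  intros He Heta Hxi Hf. destruct HC as [HC1 Hsm].
  set (A := fun z => Y z /\ ns_dist z a < r).
  destruct (mcshane A e (fun z => f z - xi z)) as [G [HG HGf]]; [lra| |].
  { intros z w [Hz Hz'] [Hw Hw'].
    replace (f z - xi z - (f w - xi w)) with (f z - f w - (xi z - xi w)) by ring.
    rewrite <- (bl_sub xi) by auto. auto. }
  destruct (Hsm G e ltac:(lra) HG eta Heta) as [K [HK [HKL HKG]]].
  exists (fun x => xi x + K x). split; [|split; [|split]].
  - apply smooth_add; auto. intros x. apply strict_diff_linear; auto.
  - intros z w Hz Hw Hzr Hwr.
    assert (E : forall y, A y -> xi y + K y - f y = K y - G y).
    { intros y Hy. rewrite (HGf y Hy). ring. }
    rewrite !E by (split; auto).
    replace (K z - G z - (K w - G w)) with ((K z - K w) + - (G z - G w)) by ring.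
    eapply Rle_trans; [apply Rabs_triang|]. rewrite Rabs_Ropp.
    pose proof (HKL z w I I). pose proof (HG z w I I). lra.
  - intros z Hz Hzr. replace (xi z + K z - f z) with (- (G z - K z)).
    + rewrite Rabs_Ropp. apply HKG.
    + rewrite HGf by (split; auto). ring.
  - intros L HL z w _ _.
    replace (xi z + K z - (xi w + K w)) with (xi (ns_add z (ns_opp w)) + (K z - K w))
      by (rewrite bl_sub by auto; ring).
    eapply Rle_trans; [apply Rabs_triang|].
    pose proof (HKL z w I I). pose proof (HL (ns_add z (ns_opp w))) as H1.
    fold (ns_dist z w) in H1. lra.
Qed.

Lemma discrete_cutoff (E : X -> Prop) t : 0 < t <= 1 ->
  exists phi, cutoff phi /\
    (forall x e, E e -> ns_dist x e < t / 2 -> phi x = 1) /\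
    forall x, (exists e, E e /\ ns_dist x e < t) \/
      exists d, 0 < d /\ forall z, ns_dist z x < d -> phi z = 0.
Proof.
  intros Ht. destruct (dist_to_set E) as [d [HdL [Hd01 [HdE Hd]]]].
  (* Applied to [t - d], the cutoff is 1 where [d <= t / 2] and 0 where [d >= 3 t / 4]; the
     remaining quarter gives a neighbourhood on which it vanishes. *)
  destruct (cutoff_exists C (fun x => t - d x) (t / 4) HC) as [phi [Hphi [H1 H0]]].
  - intros x y _ _. replace (t - d x - (t - d y)) with (- (d x - d y)) by ring.
    rewrite Rabs_Ropp. apply HdL; auto.
  - lra.
  - exists phi. split; [auto|split].
    + intros x e He Hxe. apply H1. pose proof (Rabs_le_inv _ _ (HdL x e I I)).
      rewrite (HdE e He) in *. lra.
    + intros x. destruct (Rlt_le_dec (d x) t) as [Hlt|Hge]; [left; apply Hd; lra|].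
      right. exists (t / 4). split; [lra|]. intros z Hz. apply H0.
      pose proof (Rabs_le_inv _ _ (HdL z x I I)). lra.
Qed.

(** Smoothness is obtained only near [Y], where the families cover. The error is [C * e + e] from
    the pieces and [e] from the cutoffs. The last conclusion is conditional on bounds for [f] and
    [xi], so that the general and the Lipschitz case share one construction. *)
Lemma approximation_near (Y : X -> Prop) (f : X -> R) (e : R) (xi : X -> X -> R) (r : X -> R) :
  0 < e ->
  (forall a, Y a -> 0 < r a /\ bounded_linear (xi a) /\
     forall z w, Y z -> Y w -> ns_dist z a < r a -> ns_dist w a < r a ->
       Rabs (f z - f w - xi a (ns_add z (ns_opp w))) <= e * ns_dist z w) ->
  exists g,
    (forall y, Y y -> exists d, 0 < d /\
       forall x, ns_dist x y < d -> strict_diff (fun _ => True) g x) /\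
    (forall y, Y y -> near_lip Y (C * e + e + e) (fun z => g z - f z) y) /\
    forall L, 0 <= L -> lipschitz_on Y L f ->
      (forall a x, Y a -> Rabs (xi a x) <= L * ns_norm x) ->
      forall y, Y y -> near_lip (fun _ => True) (L + C * e + e) g y.
Proof.
  intros He Hloc. assert (HC1 : 1 <= C) by apply HC.
  assert (HCe : 0 < C * e) by (apply Rmult_lt_0_compat; lra).
  destruct (stone_families Y r) as [E [HEY [HEsep HEcov]]]; [intros a Ha; apply Hloc; auto|].
  (* Twice [t n] is below the separation [2^-(n+1)], so a point is within [t n] of the family of at
     most one centre [a]; and [t n < 2^-n] keeps such a point in the ball of radius [r a]. *)
  set (t := fun n => (/ 2) ^ n / 8).
  assert (Ht : forall n, 0 < t n <= 1).
  { intros n. unfold t. pose proof (half_pow_pos n).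
    assert ((/ 2) ^ n <= 1 ^ n) by (apply pow_incr; lra). rewrite pow1 in *. lra. }
  destruct (choice _ (fun n => discrete_cutoff (fun x => exists a, E n a x) (t n) (Ht n)))
    as [phi Hphi].
  assert (Hcut : forall n, cutoff (phi n)) by (intros n; apply Hphi).
  destruct (weight_budget phi e Hcut He) as [M [eta HM]].
  (* Pieces are indexed by centre and level, since the accuracy [eta n] depends on the level. *)
  destruct (choice (fun (an : X * nat) h => Y (fst an) -> smooth h /\
    (forall z w, Y z -> Y w -> ns_dist z (fst an) < r (fst an) ->
       ns_dist w (fst an) < r (fst an) ->
       Rabs ((h z - f z) - (h w - f w)) <= (C * e + e) * ns_dist z w) /\
    (forall z, Y z -> ns_dist z (fst an) < r (fst an) -> Rabs (h z - f z) < eta (snd an)) /\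
    forall L, (forall x, Rabs (xi (fst an) x) <= L * ns_norm x) -> lipschitz (L + C * e) h))
    as [H HH].
  { intros [a n]. simpl. destruct (classic (Y a)) as [Ha|Ha].
    - destruct (Hloc a Ha) as [Hr [Hxi Hf]].
      destruct (affine_piece Y f e (xi a) a (r a) (eta n) He) as [h Hh]; auto; [apply HM|].
      exists h. auto.
    - exists (fun _ => 0). intros Ha'. contradiction. }
  (* The level-[n] function follows the piece of the unique nearby centre; elsewhere its value is
     immaterial because the cutoff vanishes. *)
  destruct (choice (fun (nz : nat * X) v => forall a b, E (fst nz) a b ->
      ns_dist (snd nz) b < t (fst nz) -> v = H (a, fst nz) (snd nz))) as [h0 Hh0].
  { intros [n z]. simpl.
    destruct (classic (exists a b, E n a b /\ ns_dist z b < t n)) as [[a [b [Hab Hzb]]]|Hno].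
    - exists (H (a, n) z). intros a' b' Hab' Hzb'.
      destruct (classic (a = a')) as [->|Hne]; auto. exfalso.
      pose proof (HEsep n a a' b b' Hab Hab' Hne) as Hsep.
      pose proof (ns_dist_tri b z b'). rewrite (ns_dist_sym b z) in *.
      unfold t in *. simpl in Hsep. pose proof (half_pow_pos n). lra.
    - exists 0. intros a b Hab Hzb. exfalso. eauto. }
  set (h := fun n z => h0 (n, z)).
  assert (Hdich : forall n x,
    (exists a d, Y a /\ 0 < d /\ forall z, ns_dist z x < d ->
       h n z = H (a, n) z /\ ns_dist z a < r a) \/
    exists d, 0 < d /\ forall z, ns_dist z x < d -> phi n z = 0).
  { intros n x. destruct (Hphi n) as [_ [_ Hd]].
    destruct (Hd x) as [[b [[a Hab] Hxb]]|Hz]; [left|right; auto].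
    exists a, (t n - ns_dist x b). destruct (HEY n a b Hab) as [Ya Hba].
    split; [auto|split; [lra|]]. intros z Hz.
    pose proof (ns_dist_tri z x b) as Hzb. split.
    - apply (Hh0 (n, z) a b); auto. simpl. lra.
    - pose proof (ns_dist_tri z b a). unfold t in *. pose proof (half_pow_pos n). lra. }
  assert (Hcov : forall y, Y y -> exists d, 0 < d /\
    forall x, ns_dist x y < d -> covered phi x).
  { intros y Hy. destruct (HEcov y Hy) as [n [a Hay]].
    destruct (Hphi n) as [_ [H1 _]].
    exists (t n / 4). split; [specialize (Ht n); lra|]. intros x Hx.
    exists n, (t n / 4). split; [specialize (Ht n); lra|]. intros z Hz.
    apply (H1 z y); [eauto|]. pose proof (ns_dist_tri z x y). specialize (Ht n). lra. }
  assert (Hcovy : forall y, Y y -> covered phi y).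
  { intros y Hy. destruct (Hcov y Hy) as [d [Hd Hc]]. apply Hc. rewrite dist_self. auto. }
  destruct (blend_exists phi h) as [g Hg]. exists g. split; [|split].
  - intros y Hy. destruct (Hcov y Hy) as [d [Hd Hc]]. exists d. split; auto. intros x Hx.
    apply (blend_strict_diff phi Hcut h); auto. intros n.
    destruct (Hdich n x) as [[a [d' [Ya [Hd' Hz]]]]|Hz]; [right|left; auto].
    apply (strict_diff_local _ (fun _ => True) (H (a, n))); [|apply (HH (a, n)); auto].
    exists d'. split; auto. intros z _ Hzx. split; auto. symmetry. apply Hz. auto.
  - intros y Hy.
    apply (blend_near_lip phi Hcut h g M eta e Hg) with (F := f); auto.
    + intros n. apply HM.
    + lra.
    + intros n. apply HM.
    + intros n. destruct (Hdich n y) as [[a [d' [Ya [Hd' Hz]]]]|[d [Hd Hz]]].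
      * right. destruct (HH (a, n) Ya) as [_ [Hlip [Hclose _]]]. simpl in *.
        split; exists d'; (split; [auto|]).
        -- intros z w Yz Yw Hzy Hwy. destruct (Hz z Hzy) as [-> Hza].
           destruct (Hz w Hwy) as [-> Hwa]. auto.
        -- intros z Yz Hzy. destruct (Hz z Hzy) as [-> Hza]. apply Rlt_le. auto.
      * left. exists d. split; auto.
  - intros L HL HfL Hxi y Hy.
    (* Points off [Y] now matter, so the common target has to be an extension of [f] from [Y]. *)
    destruct (mcshane Y L f HL HfL) as [F [HF HFf]].
    apply (near_lip_local _ (fun _ => True) _ (fun z => g z - 0)).
    { exists 1. split; [lra|]. split; auto. intros. ring. }
    apply (blend_near_lip phi Hcut h g M eta e Hg) with (F := F) (lam := fun _ => 0); auto.
    + intros n. apply HM.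
    + lra.
    + intros n. apply HM.
    + intros n. destruct (Hdich n y) as [[a [d' [Ya [Hd' Hz]]]]|[d [Hd Hz]]].
      * right. destruct (HH (a, n) Ya) as [_ [_ [Hclose Hlip]]]. simpl in *.
        specialize (Hlip L ltac:(auto)).
        split.
        -- exists d'. split; auto. intros z w _ _ Hzy Hwy.
           destruct (Hz z Hzy) as [-> _]. destruct (Hz w Hwy) as [-> _].
           rewrite !Rminus_0_r. apply Hlip; auto.
        -- specialize (Hclose y Hy). destruct (Hz y) as [_ Hya]; [rewrite dist_self; auto|].
           specialize (Hclose Hya). rewrite <- (HFf y Hy) in Hclose.
           (* At [y] the piece is strictly closer than [eta n] to the target. Both are Lipschitz, so
              this gap keeps the estimate valid on a ball of [X]; [k] exceeds the sum of their
              constants. *)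
           set (gap := eta n - Rabs (H (a, n) y - F y)).
           set (k := L + C * e + L + 1).
           assert (Hk : 0 < k) by (unfold k; lra).
           exists (Rmin d' (gap / k)).
           split; [apply Rmin_glb_lt; auto; apply Rdiv_lt_0_compat; unfold gap; lra|].
           intros z _ Hzy. pose proof (Rmin_l d' (gap / k)). pose proof (Rmin_r d' (gap / k)).
           destruct (Hz z ltac:(lra)) as [-> _].
           pose proof (Hlip z y I I) as B1. pose proof (HF z y I I) as B2.
           replace (H (a, n) z - F z) with ((H (a, n) y - F y) +
             ((H (a, n) z - H (a, n) y) + - (F z - F y))) by ring.
           eapply Rle_trans; [apply Rabs_triang|].
           assert (B3 : Rabs ((H (a, n) z - H (a, n) y) + - (F z - F y)) <= k * ns_dist z y).
           { eapply Rle_trans; [apply Rabs_triang|]. rewrite Rabs_Ropp.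
             pose proof (dist_ge0 z y). unfold k. lra. }
           assert (B4 : k * ns_dist z y <= gap).
           { apply Rle_trans with (k * (gap / k)); [apply Rmult_le_compat_l; lra|].
             apply Req_le. field. lra. }
           unfold gap in B4. lra.
      * left. exists d. split; auto.
Qed.

End NearApproximation.

(** * Global approximation by gluing *)

Section GlobalApproximation.
Context {X : NormedSpace}.
Variable C : R.
Hypothesis HC : smoothing_constant X C.

(** An exhaustion of the open set where [d] is positive by cutoffs that vanish near its complement
    when [d] is nonnegative. *)
Lemma positivity_cutoffs (d : X -> R) : lipschitz 1 d ->
  exists phi : nat -> X -> R, forall n, cutoff (phi n) /\
    (forall x, d x <= (/ 2) ^ n -> phi n x = 0) /\ (forall x, 2 * (/ 2) ^ n <= d x -> phi n x = 1).
Proof.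
  intros Hd. apply (choice (fun n phi => cutoff phi /\ (forall x, d x <= (/ 2) ^ n -> phi x = 0) /\
    (forall x, 2 * (/ 2) ^ n <= d x -> phi x = 1))). intros n.
  destruct (cutoff_exists C d ((/ 2) ^ n) HC Hd (half_pow_pos n)) as [phi [H1 [H2 H3]]].
  exists phi. auto.
Qed.

Lemma positivity_covered (d : X -> R) (phi : nat -> X -> R) x :
  lipschitz 1 d -> (forall n z, 2 * (/ 2) ^ n <= d z -> phi n z = 1) -> 0 < d x ->
  exists n r, 0 < r /\ forall z, ns_dist z x < r -> phi n z = 1.
Proof.
  intros Hd Hphi Hx. destruct (half_pow_small (d x / 4)) as [n Hn]; [lra|].
  exists n, (d x / 4). split; [lra|]. intros z Hz. apply Hphi.
  pose proof (Rabs_le_inv _ _ (Hd z x I I)). lra.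
Qed.

Lemma positivity_zero (d : X -> R) (phi : nat -> X -> R) n x :
  lipschitz 1 d -> (forall z, d z <= (/ 2) ^ n -> phi n z = 0) -> d x = 0 ->
  exists r, 0 < r /\ forall z, ns_dist z x < r -> phi n z = 0.
Proof.
  intros Hd Hphi Hx. exists ((/ 2) ^ n). split; [apply half_pow_pos|]. intros z Hz. apply Hphi.
  pose proof (Rabs_le_inv _ _ (Hd z x I I)). lra.
Qed.

(** [X] is covered by [W] and the complement of [Y]: [G] is used on the first set, [k] on the
    second. [k] is a family because the level-[n] piece must be [eta n]-close to [F]. Near [Y] only
    copies of [G] remain active, which preserves [G] there up to slope [e]. *)
Lemma glue (Y W : X -> Prop) (G : X -> R) (k : R -> X -> R) e :
  is_closed Y -> is_open W -> (forall y, Y y -> W y) ->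
  (forall x, W x -> strict_diff (fun _ => True) G x) ->
  (forall eta, 0 < eta -> smooth (k eta)) -> 0 < e ->
  exists g, smooth g /\
    (forall y, Y y -> near_lip (fun _ => True) e (fun z => g z - G z) y) /\
    forall c F, 0 <= c -> (forall eta x, 0 < eta -> Rabs (k eta x - F x) <= eta) ->
      (forall eta, 0 < eta -> lipschitz c (k eta)) -> (forall x, W x -> G x = F x) ->
      lipschitz c F -> lipschitz (c + e) g.
Proof.
  intros HY HW HYW HG Hk He.
  destruct (dist_to_set Y) as [dY [HdY [_ [HdY0 HdYe]]]].
  destruct (dist_to_set (fun x => ~ W x)) as [dW [HdW [_ [HdW0 HdWe]]]].
  destruct (positivity_cutoffs dY HdY) as [phY HphY].
  destruct (positivity_cutoffs dW HdW) as [phW HphW].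
  (* Interleaving both exhaustions, even levels for [W] and odd ones for the complement of [Y],
     gives one sequence with one error budget. *)
  set (phi := fun n => if Nat.even n then phW (Nat.div2 n) else phY (Nat.div2 n)).
  assert (Hcut : forall n, cutoff (phi n)).
  { intros n. unfold phi. destruct (Nat.even n); [apply HphW|apply HphY]. }
  destruct (weight_budget phi e Hcut He) as [M [eta HM]].
  set (h := fun n => if Nat.even n then G else k (eta n)).
  assert (HdWpos : forall x, W x -> 0 < dW x).
  { intros x Hx. apply (dist_to_closed (fun x => ~ W x) dW); auto.
    intros z Hz. apply NNPP in Hz. destruct (HW z Hz) as [r [Hr Hzr]].
    exists r. split; auto. }
  assert (Hcov : forall x, covered phi x).
  { intros x. destruct (classic (Y x)) as [Hx|Hx].
    - destruct (positivity_covered dW phW x HdW) as [n [r [Hr Hz]]]; auto.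
      { intros n. apply HphW. }
      exists (2 * n)%nat, r. split; auto. intros z Hzx. unfold phi.
      rewrite Nat.even_mul. simpl orb. rewrite Nat.div2_double. auto.
    - destruct (positivity_covered dY phY x HdY) as [n [r [Hr Hz]]]; auto.
      { intros n. apply HphY. }
      { apply (dist_to_closed Y); auto. }
      exists (S (2 * n))%nat, r. split; auto. intros z Hzx. unfold phi.
      replace (Nat.even (S (2 * n))) with false
        by (rewrite Nat.even_succ, Nat.odd_mul; reflexivity).
      rewrite Nat.div2_succ_double. auto. }
  destruct (blend_exists phi h) as [g Hg]. exists g.
  assert (Hlev : forall n x, (Nat.even n = true /\ W x) \/ Nat.even n = false \/
    exists d, 0 < d /\ forall z, ns_dist z x < d -> phi n z = 0).
  { intros n x. unfold phi. destruct (Nat.even n); auto.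
    destruct (classic (W x)) as [Hx|Hx]; auto. right. right.
    apply (positivity_zero dW); auto. apply HphW. }
  assert (Hsm : smooth g).
  { intros x. apply (blend_strict_diff phi Hcut h); auto. intros n. unfold h.
    destruct (Hlev n x) as [[-> Hx]|[->|Hz]]; auto. right. apply Hk. apply HM. }
  split; [auto|split].
  - intros y Hy. replace e with (0 + e) by ring.
    apply (blend_near_lip phi Hcut h g M eta e Hg) with (F := G); auto; try lra.
    + intros n. apply HM.
    + intros n. apply HM.
    + intros n. unfold h. destruct (Nat.even n) eqn:En.
      * right. split; exists 1; (split; [lra|]).
        -- intros z w _ _ _ _. match goal with |- Rabs ?a <= _ => replace a with 0 by ring end.
           rewrite Rabs_R0. lra.
        -- intros z _ _. rewrite Rminus_diag, Rabs_R0. apply Rlt_le, HM.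
      * left. unfold phi. rewrite En.
        destruct (positivity_zero dY phY (Nat.div2 n) y HdY) as [d [Hd Hz]]; auto.
        { apply HphY. }
        exists d. auto.
  - intros c F Hc HkF Hkc HGF HF. apply near_lip_convex; [apply convex_full|].
    intros x _. apply (near_lip_local _ (fun _ => True) _ (fun z => g z - 0)).
    { exists 1. split; [lra|]. split; auto. intros. ring. }
    apply (blend_near_lip phi Hcut h g M eta e Hg) with (F := F) (lam := fun _ => 0); auto; try lra.
    + intros n. apply HM.
    + intros n. apply HM.
    + intros n. destruct (HM n) as [_ [Heta _]].
      unfold h. destruct (Hlev n x) as [[-> Hx]|[->|[d [Hd Hz]]]]; [right|right|left].
      * destruct (HW x Hx) as [r [Hr HWr]]. split; exists r; (split; [auto|]).
        -- intros z w _ _ Hz Hw. rewrite !HGF, !Rminus_0_r by auto. auto.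
        -- intros z _ Hz. rewrite HGF, Rminus_diag, Rabs_R0 by auto. lra.
      * split; exists 1; (split; [lra|]).
        -- intros z w _ _ _ _. rewrite !Rminus_0_r. apply Hkc; auto.
        -- intros z _ _. auto.
      * exists d. auto.
Qed.

(** * Approximation on a closed convex set *)

Section OnConvex.
Variable Y : X -> Prop.
Hypothesis HYc : is_closed Y.
Hypothesis HYv : is_convex Y.

(** Contracting [Y] towards [a] stays in [Y] by convexity and moves [z] and [w] into the ball where
    [l] approximates [f]; their difference is only scaled, and the factor cancels. *)
Lemma derivative_bound (f l : X -> R) a L e :
  Y a -> lipschitz_on Y L f -> lin_approx Y f a e l ->
  forall z w, Y z -> Y w -> Rabs (l (ns_add z (ns_opp w))) <= (L + e) * ns_dist z w.
Proof.
  intros Ha HL [[la [ls lb]] [d [Hd H]]] z w Hz Hw.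
  set (R0 := ns_dist z a + ns_dist w a + d).
  assert (HR0 : 0 < R0) by (unfold R0; pose proof (dist_ge0 z a); pose proof (dist_ge0 w a); lra).
  set (t := / 2 * (d / R0)).
  assert (Hdr : 0 < d / R0 <= 1).
  { split; [apply Rdiv_lt_0_compat; auto|]. apply Rmult_le_reg_r with R0; auto.
    unfold Rdiv. rewrite Rmult_assoc, Rinv_l by lra. unfold R0.
    pose proof (dist_ge0 z a). pose proof (dist_ge0 w a). lra. }
  assert (Ht : 0 < t <= 1) by (unfold t; lra).
  set (p := fun v => ns_add a (ns_scal t (ns_add v (ns_opp a)))).
  assert (Hp : forall v, Y v -> Y (p v)) by (intros v Hv; apply convex_segment; auto; lra).
  assert (Hpa : forall v, ns_dist v a <= R0 -> ns_dist (p v) a < d).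
  { intros v Hv. unfold p. rewrite dist_add, ns_norm_scal, Rabs_right by lra.
    fold (ns_dist v a). apply Rle_lt_trans with (t * R0); [apply Rmult_le_compat_l; lra|].
    unfold t. replace (/ 2 * (d / R0) * R0) with (d / 2) by (field; lra). lra. }
  assert (Hdiff : ns_add (p z) (ns_opp (p w)) = ns_scal t (ns_add z (ns_opp w)))
    by (unfold p; vec).
  assert (Hdist : ns_dist (p z) (p w) = t * ns_dist z w).
  { unfold ns_dist. rewrite Hdiff, ns_norm_scal, Rabs_right by lra. reflexivity. }
  assert (H1 := H (p z) (p w) (Hp z Hz) (Hp w Hw)
    (Hpa z ltac:(unfold R0; pose proof (dist_ge0 w a); lra))
    (Hpa w ltac:(unfold R0; pose proof (dist_ge0 z a); lra))).
  assert (H2 := HL (p z) (p w) (Hp z Hz) (Hp w Hw)).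
  rewrite Hdiff, ls in H1. rewrite Hdist in H1, H2.
  apply Rmult_le_reg_l with t; [lra|].
  rewrite <- (Rabs_right t) at 1 by lra. rewrite <- Rabs_mult.
  apply Rabs_le_inv in H1. apply Rabs_le_inv in H2. apply Rabs_le. lra.
Qed.

Lemma is_open_balls (rho : X -> R) :
  is_open (fun x => exists y, Y y /\ ns_dist x y < rho y).
Proof.
  intros x [y [Hy Hxy]]. exists (rho y - ns_dist x y). split; [lra|].
  intros z Hz. exists y. split; auto. pose proof (ns_dist_tri z x y). lra.
Qed.

Lemma choice_on (P : X -> R -> Prop) :
  (forall y, Y y -> exists d, 0 < d /\ P y d) ->
  exists rho, forall y, Y y -> 0 < rho y /\ P y (rho y).
Proof.
  intros H. apply (choice (fun y d => Y y -> 0 < d /\ P y d)). intros y.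
  destruct (classic (Y y)) as [Hy|Hy].
  - destruct (H y Hy) as [d Hd]. exists d. auto.
  - exists 0. contradiction.
Qed.

Lemma approximation (f : X -> R) e : 0 < e -> (forall y, Y y -> strict_diff Y f y) ->
  exists g, smooth g /\ lipschitz_on Y e (fun x => f x - g x).
Proof.
  intros He Hf. assert (HC1 : 1 <= C) by apply HC.
  (* [C + 2] units are spent near [Y] and one in the gluing. *)
  set (e0 := e / (C + 3)).
  assert (He0 : 0 < e0) by (apply Rdiv_lt_0_compat; lra).
  destruct (choice (fun a (xr : (X -> R) * R) => Y a -> 0 < snd xr /\ bounded_linear (fst xr) /\
     forall z w, Y z -> Y w -> ns_dist z a < snd xr -> ns_dist w a < snd xr ->
       Rabs (f z - f w - fst xr (ns_add z (ns_opp w))) <= e0 * ns_dist z w)) as [xr Hxr].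
  { intros a. destruct (classic (Y a)) as [Ha|Ha].
    - destruct (Hf a Ha e0 He0) as [l [Hl [d [Hd H]]]]. exists (l, d). auto.
    - exists (f, 0). contradiction. }
  destruct (approximation_near C HC Y f e0 (fun a => fst (xr a)) (fun a => snd (xr a)) He0 Hxr)
    as [g1 [Hg1 [Hg1f _]]].
  destruct (choice_on (fun y d => forall x, ns_dist x y < d -> strict_diff (fun _ => True) g1 x))
    as [rho Hrho]; [exact Hg1|].
  (* No Lipschitz bound is asked for off [Y], so the zero function serves there. *)
  destruct (glue Y (fun x => exists y, Y y /\ ns_dist x y < rho y) g1 (fun _ _ => 0) e0)
    as [g [Hg [Hgg1 _]]]; auto.
  - apply is_open_balls.
  - intros y Hy. exists y. rewrite dist_self. split; auto. apply Hrho; auto.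
  - intros x [y [Hy Hxy]]. apply (Hrho y); auto.
  - intros. apply smooth_const.
  - exists g. split; auto. apply near_lip_convex; auto. intros y Hy.
    pose proof (near_lip_add Y _ _ _ _ y (Hg1f y Hy)
      (near_lip_local Y (fun _ => True) e0 _ (fun z => g z - g1 z) y
        (ex_intro _ 1 (conj Rlt_0_1 (conj (fun _ _ _ => I) (fun _ _ _ _ _ _ => eq_refl))))
        (Hgg1 y Hy))) as Hsum.
    destruct Hsum as [d [Hd Hsum]]. exists d. split; auto. intros z w Hz Hw Hzy Hwy.
    specialize (Hsum z w Hz Hw Hzy Hwy).
    replace (f z - g z - (f w - g w)) with
      (- (g1 z - f z + (g z - g1 z) - (g1 w - f w + (g w - g1 w)))) by ring.
    rewrite Rabs_Ropp. eapply Rle_trans; [apply Hsum|].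
    apply Req_le. unfold e0. field. lra.
Qed.

Lemma lipschitz_approximation (f : X -> R) L e : 0 < L -> 0 < e ->
  (forall y, Y y -> strict_diff Y f y) -> lipschitz_on Y L f ->
  exists g, smooth g /\ lipschitz ((7 * C + 1) * L) g /\ lipschitz_on Y e (fun x => f x - g x).
Proof.
  intros HL He Hf HfL. assert (HC1 : 1 <= C) by apply HC.
  (* The minimum with [L] makes all error terms at most [L], so they alter the Lipschitz constants
     only by fixed multiples of [L]. *)
  set (e0 := Rmin e L / (C + 3)).
  assert (Hmin : 0 < Rmin e L) by (apply Rmin_glb_lt; auto).
  assert (He0 : 0 < e0) by (apply Rdiv_lt_0_compat; lra).
  assert (HCe0 : C * e0 + e0 + e0 + e0 = Rmin e L) by (unfold e0; field; lra).
  assert (HCpos : 0 < C * e0) by (apply Rmult_lt_0_compat; lra).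
  pose proof (Rmin_l e L) as Hmin1. pose proof (Rmin_r e L) as Hmin2.
  destruct (choice (fun a (xr : (X -> R) * R) => Y a -> (0 < snd xr /\ bounded_linear (fst xr) /\
     forall z w, Y z -> Y w -> ns_dist z a < snd xr -> ns_dist w a < snd xr ->
       Rabs (f z - f w - fst xr (ns_add z (ns_opp w))) <= e0 * ns_dist z w) /\
     forall x, Rabs (fst xr x) <= 2 * L * ns_norm x)) as [xr Hxr].
  { intros a. destruct (classic (Y a)) as [Ha|Ha].
    - destruct (Hf a Ha e0 He0) as [l Hl].
      (* The bound [2 * L] covers the derivative bound [L + e0]. *)
      destruct (extend_from_convex Y a l (2 * L) HYv Ha (proj1 Hl)) as [xi [Hxi [HxiL Hxil]]].
      + lra.
      + intros z w Hz Hw. eapply Rle_trans; [apply (derivative_bound f l a L e0); auto|].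
        apply Rmult_le_compat_r; [apply dist_ge0|lra].
      + destruct Hl as [Hl [d [Hd H]]]. exists (xi, d). intros _. simpl.
        split; [split; [auto|split; [auto|]]|auto].
        intros z w Hz Hw Hza Hwa. rewrite Hxil by auto. auto.
    - exists (f, 0). contradiction. }
  destruct (approximation_near C HC Y f e0 (fun a => fst (xr a)) (fun a => snd (xr a)) He0)
    as [g1 [Hg1 [Hg1f Hg1L]]]; [intros a Ha; apply Hxr; auto|].
  specialize (Hg1L (2 * L) ltac:(lra) (lipschitz_on_le Y L (2 * L) f ltac:(lra) HfL)
    (fun a x Ha => proj2 (Hxr a Ha) x)).
  assert (Hg1Y : lipschitz_on Y (2 * L) g1).
  { intros z w Hz Hw.
    pose proof (near_lip_convex Y _ _ HYv Hg1f z w Hz Hw) as H1.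
    pose proof (HfL z w Hz Hw) as H2. pose proof (dist_ge0 z w) as Hzw.
    replace (g1 z - g1 w) with ((g1 z - f z - (g1 w - f w)) + (f z - f w)) by ring.
    eapply Rle_trans; [apply Rabs_triang|].
    assert ((C * e0 + e0 + e0) * ns_dist z w <= L * ns_dist z w)
      by (apply Rmult_le_compat_r; lra).
    lra. }
  (* The estimates hold on balls four times as large as those forming [W]: if [x] is in the ball of
     [y] and [x'] is within [2 * rho y] of [x], then [x'] is still within [3 * rho y] of [y]. *)
  destruct (choice_on (fun y d =>
      (forall x, ns_dist x y < 4 * d -> strict_diff (fun _ => True) g1 x) /\
      forall z w, ns_dist z y < 4 * d -> ns_dist w y < 4 * d ->
        Rabs (g1 z - g1 w) <= 3 * L * ns_dist z w)) as [rho Hrho].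
  { intros y Hy. destruct (Hg1 y Hy) as [d1 [Hd1 H1]].
    destruct (near_lip_le _ (2 * L + C * e0 + e0) (3 * L) _ _ ltac:(lra) (Hg1L y Hy)) as [d2 [Hd2 H2]].
    pose proof (Rmin_l d1 d2). pose proof (Rmin_r d1 d2).
    exists (Rmin d1 d2 / 4). split; [|split].
    - assert (0 < Rmin d1 d2) by (apply Rmin_glb_lt; auto). lra.
    - intros x Hx. apply H1. lra.
    - intros z w Hz Hw. apply H2; auto; lra. }
  set (W := fun x => exists y, Y y /\ ns_dist x y < rho y).
  (* Nearby points lie in one enlarged ball, where [3 * L] suffices. Otherwise the legs to the
     centres have total length at most [ns_dist x x'], the centres are at most twice as far apart,
     and [3 * L + 2 * (2 * L) = 7 * L]. *)
  assert (HW7 : forall x x' y y', Y y -> Y y' -> ns_dist x y < rho y -> ns_dist x' y' < rho y' ->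
    rho y' <= rho y -> Rabs (g1 x - g1 x') <= 7 * L * ns_dist x x').
  { intros x x' y y' Hy Hy' Hx Hx' Hle.
    destruct (Hrho y Hy) as [Hpos [_ Hl]]. destruct (Hrho y' Hy') as [Hpos' [_ Hl']].
    pose proof (dist_ge0 x x') as Hxx'. pose proof (dist_ge0 x y) as Hxy.
    pose proof (dist_ge0 x' y') as Hxy'.
    destruct (Rlt_le_dec (ns_dist x x') (2 * rho y)) as [Hnear|Hfar].
    - pose proof (ns_dist_tri x' x y) as Htri. rewrite (ns_dist_sym x' x) in Htri.
      specialize (Hl x x' ltac:(lra) ltac:(lra)).
      assert (0 <= L * ns_dist x x') by (apply Rmult_le_pos; lra). lra.
    - (* far apart points are compared through the centres of their balls *)
      pose proof (Hl x y ltac:(lra) ltac:(rewrite dist_self; lra)) as H1.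
      pose proof (Hl' x' y' ltac:(lra) ltac:(rewrite dist_self; lra)) as H2.
      pose proof (Hg1Y y y' Hy Hy') as H3.
      pose proof (ns_dist_tri y x y') as T1. pose proof (ns_dist_tri x x' y') as T2.
      rewrite (ns_dist_sym y x) in T1.
      replace (g1 x - g1 x') with ((g1 x - g1 y) + ((g1 y - g1 y') + - (g1 x' - g1 y'))) by ring.
      eapply Rle_trans; [apply Rabs_triang|].
      eapply Rle_trans; [apply Rplus_le_compat_l, Rabs_triang|]. rewrite Rabs_Ropp.
      assert (Hs : ns_dist x y + ns_dist x' y' <= ns_dist x x') by lra.
      apply (Rmult_le_compat_l L) in Hs; [|lra].
      assert (Hs' : ns_dist y y' <= 2 * ns_dist x x') by lra.
      apply (Rmult_le_compat_l L) in Hs'; [|lra]. lra. }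
  (* Off [W] nothing is known of [g1]; its extension [F] takes over there and is smoothed to give
     the outer pieces of the gluing. *)
  destruct (mcshane W (7 * L) g1) as [F [HF HFg1]]; [lra| |].
  { intros x x' [y [Hy Hx]] [y' [Hy' Hx']]. destruct (Rle_lt_dec (rho y') (rho y)).
    - apply (HW7 x x' y y'); auto.
    - replace (g1 x - g1 x') with (- (g1 x' - g1 x)) by ring.
      rewrite Rabs_Ropp, ns_dist_sym. apply (HW7 x' x y' y); auto. lra. }
  destruct (choice (fun eta K => 0 < eta -> smooth K /\ lipschitz (C * (7 * L)) K /\
    forall x, Rabs (F x - K x) < eta)) as [k Hk].
  { intros eta. destruct (Rlt_le_dec 0 eta) as [Heta|Heta].
    - destruct HC as [_ Hsm]. destruct (Hsm F (7 * L) ltac:(lra) HF eta Heta) as [K HK].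
      exists K. auto.
    - exists F. intros. lra. }
  assert (HWY : forall y, Y y -> W y).
  { intros y Hy. exists y. rewrite dist_self. split; auto. apply Hrho; auto. }
  assert (HWo : is_open W) by apply is_open_balls.
  destruct (glue Y W F k e0) as [g [Hg [HgF Hglip]]]; auto.
  - intros x Hx. apply (strict_diff_local _ (fun _ => True) g1).
    + destruct (HWo x Hx) as [r [Hr Hz]]. exists r. split; auto. intros z _ Hzx.
      split; auto. symmetry. auto.
    + destruct Hx as [y [Hy Hxy]]. destruct (Hrho y Hy) as [Hpos [Hs _]].
      apply Hs. lra.
  - intros eta Heta. apply Hk; auto.
  - exists g. split; [auto|split].
    + apply (lipschitz_on_le _ (C * (7 * L) + e0)).
      { assert (1 * e0 <= C * e0) by (apply Rmult_le_compat_r; lra). lra. }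
      assert (1 * (7 * L) <= C * (7 * L)) by (apply Rmult_le_compat_r; lra).
      apply (Hglip _ F); auto; [lra| | |].
      * intros eta x Heta. rewrite Rabs_minus_sym. apply Rlt_le, Hk; auto.
      * intros eta Heta. apply Hk; auto.
      * apply (lipschitz_on_le _ (7 * L)); auto. lra.
    + apply near_lip_convex; auto. intros y Hy.
      pose proof (near_lip_add Y _ _ _ _ y (Hg1f y Hy)
        (near_lip_local Y (fun _ => True) e0 _ (fun z => g z - F z) y
          (ex_intro _ 1 (conj Rlt_0_1 (conj (fun _ _ _ => I) (fun _ _ _ _ _ _ => eq_refl))))
          (HgF y Hy))) as Hsum.
      destruct Hsum as [d [Hd Hsum]]. exists d. split; auto. intros z w Hz Hw Hzy Hwy.
      specialize (Hsum z w Hz Hw Hzy Hwy). rewrite !HFg1 in Hsum by auto.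
      replace (f z - g z - (f w - g w)) with
        (- (g1 z - f z + (g z - g1 z) - (g1 w - f w + (g w - g1 w)))) by ring.
      rewrite Rabs_Ropp. eapply Rle_trans; [apply Hsum|].
      apply Rmult_le_compat_r; [apply dist_ge0|lra].
Qed.

End OnConvex.
End GlobalApproximation.

(** * Summation of successive corrections *)

(** The limit is the supremum of the lower bounds [u n - 2 * K * 2^-n], each of which lies below all
    the matching upper bounds. *)
Lemma geometric_limit (u : nat -> R) K : 0 <= K ->
  (forall n, Rabs (u (S n) - u n) <= K * (/ 2) ^ n) ->
  exists l, forall n, Rabs (l - u n) <= 2 * K * (/ 2) ^ n.
Proof.
  intros HK Hu.
  assert (Hmon : forall n m, (n <= m)%nat ->
    Rabs (u m - u n) <= 2 * K * (/ 2) ^ n - 2 * K * (/ 2) ^ m).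
  { intros n m Hnm. induction Hnm as [|m Hnm IH].
    - rewrite !Rminus_diag, Rabs_R0. lra.
    - replace (u (S m) - u n) with ((u (S m) - u m) + (u m - u n)) by ring.
      eapply Rle_trans; [apply Rabs_triang|]. specialize (Hu m). simpl. lra. }
  assert (Hcmp : forall n m, u m - 2 * K * (/ 2) ^ m <= u n + 2 * K * (/ 2) ^ n).
  { intros n m. pose proof (half_pow_pos n). pose proof (half_pow_pos m).
    destruct (Nat.le_ge_cases n m) as [H1|H1]; pose proof (Rabs_le_inv _ _ (Hmon _ _ H1)); nra. }
  destruct (completeness (fun t => exists n, t = u n - 2 * K * (/ 2) ^ n)) as [l [Hup Hlub]].
  - exists (u 0%nat + 2 * K * (/ 2) ^ 0). intros t [n ->]. apply Hcmp.
  - exists (u 0%nat - 2 * K * (/ 2) ^ 0), 0%nat. reflexivity.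
  - exists l. intros n. apply Rabs_le. split.
    + assert (u n - 2 * K * (/ 2) ^ n <= l) by (apply Hup; eauto). lra.
    + assert (l <= u n + 2 * K * (/ 2) ^ n); [|lra].
      apply Hlub. intros t [m ->]. apply Hcmp.
Qed.

Lemma geometric_small a K : (forall n, a <= K * (/ 2) ^ n) -> a <= 0.
Proof.
  intros H. apply Rnot_lt_le. intros Ha.
  destruct (half_pow_small (a / (Rabs K + 1))) as [n Hn].
  { apply Rdiv_lt_0_compat; auto. pose proof (Rabs_pos K). lra. }
  specialize (H n). pose proof (half_pow_pos n). pose proof (Rle_abs K). pose proof (Rabs_pos K).
  apply (Rmult_lt_compat_r (Rabs K + 1)) in Hn; [|lra].
  replace (a / (Rabs K + 1) * (Rabs K + 1)) with a in Hn by (field; lra). nra.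
Qed.

Section Extension.
Context {X : NormedSpace}.
Variable C : R.
Hypothesis HC : smoothing_constant X C.

(** [P n] is the partial sum of corrections. All of them fix the value at [y0], so Lipschitz bounds
    on differences become pointwise bounds proportional to [ns_dist x y0], which makes the series
    converge at each point. *)
Lemma correction_sequence (Y : X -> Prop) (f : X -> R) L y0 :
  is_closed Y -> is_convex Y -> Y y0 -> 0 < L ->
  (forall y, Y y -> strict_diff Y f y) -> lipschitz_on Y L f ->
  exists P : nat -> X -> R, (forall x, P 0%nat x = f y0) /\ forall n,
    smooth (P n) /\ lipschitz_on Y (L * (/ 2) ^ n) (fun x => f x - P n x) /\
    P n y0 = f y0 /\
    lipschitz ((7 * C + 1) * L * (/ 2) ^ n) (fun x => P (S n) x - P n x).
Proof.
  intros HYc HYv Hy0 HL Hf HfL.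
  set (good := fun n s => smooth s /\ lipschitz_on Y (L * (/ 2) ^ n) (fun x => f x - s x) /\
    s y0 = f y0).
  destruct (choice (fun (ns : nat * (X -> R)) t => good (fst ns) (snd ns) ->
    good (S (fst ns)) t /\
    lipschitz ((7 * C + 1) * L * (/ 2) ^ (fst ns)) (fun x => t x - snd ns x))) as [next Hnext].
  { intros [n s]. simpl. destruct (classic (good n s)) as [[Hs [HsL Hsy]]|Hno].
    2: { exists s. contradiction. }
    destruct (lipschitz_approximation C HC Y HYc HYv (fun x => f x - s x)
      (L * (/ 2) ^ n) (L * (/ 2) ^ (S n))) as [g [Hg [HgL Hfg]]]; auto.
    - apply Rmult_lt_0_compat; auto. apply half_pow_pos.
    - apply Rmult_lt_0_compat; auto. apply half_pow_pos.
    - intros y Hy. apply strict_diff_sub; auto.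
      apply (strict_diff_local Y (fun _ => True) s); auto. exists 1. split; [lra|auto].
    (* Subtracting [g y0] normalises the correction at [y0] without affecting any slope. *)
    - exists (fun x => s x + (g x - g y0)). intros _. split; [split; [|split]|].
      + apply smooth_add; auto. apply (smooth_sub g); auto. apply smooth_const.
      + intros x y Hx Hy. specialize (Hfg x y Hx Hy).
        match type of Hfg with Rabs ?a <= _ => match goal with |- Rabs ?b <= _ =>
          replace b with a by ring end end.
        exact Hfg.
      + rewrite Hsy. ring.
      + intros x y Hx Hy. specialize (HgL x y Hx Hy).
        replace (s x + (g x - g y0) - s x - (s y + (g y - g y0) - s y)) with (g x - g y) by ring.
        rewrite <- Rmult_assoc in HgL. exact HgL. }
  set (Sq := fix Sq n := match n with
    | O => fun _ => f y0
    | S n => next (n, Sq n) end).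
  assert (Hgood : forall n, good n (Sq n)).
  { induction n as [|n IH].
    - split; [apply smooth_const|split; [|reflexivity]]. intros x y Hx Hy. simpl.
      rewrite Rmult_1_r. replace (f x - f y0 - (f y - f y0)) with (f x - f y) by ring. auto.
    - apply (Hnext (n, Sq n)). exact IH. }
  exists Sq. split; [reflexivity|]. intros n. destruct (Hgood n) as [H1 [H2 H3]].
  split; [auto|split; [auto|split; [auto|]]].
  apply (Hnext (n, Sq n)). apply Hgood.
Qed.

(** A linear approximant of [P n] also serves [H], since [H - P n] adds only a small slope. *)
Lemma smooth_limit (P : nat -> X -> R) (H : X -> R) K :
  (forall n, smooth (P n)) -> (forall n, lipschitz (K * (/ 2) ^ n) (fun x => H x - P n x)) ->
  smooth H.
Proof.
  intros HS HH x e He.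
  destruct (half_pow_small (e / 2 / (Rabs K + 1))) as [n Hn].
  { pose proof (Rabs_pos K). apply Rdiv_lt_0_compat; lra. }
  destruct (HS n x (e / 2)) as [l [Hl [d [Hd Hd']]]]; [lra|].
  exists l. split; auto. exists d. split; auto. intros z w _ _ Hz Hw.
  specialize (Hd' z w I I Hz Hw). specialize (HH n z w I I).
  assert (HK : K * (/ 2) ^ n <= e / 2).
  { pose proof (half_pow_pos n). pose proof (Rle_abs K). pose proof (Rabs_pos K).
    apply (Rmult_lt_compat_r (Rabs K + 1)) in Hn; [|lra].
    replace (e / 2 / (Rabs K + 1) * (Rabs K + 1)) with (e / 2) in Hn by (field; lra). nra. }
  apply (Rmult_le_compat_r (ns_dist z w)) in HK; [|apply dist_ge0].
  match goal with |- Rabs ?t <= _ =>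
    replace t with ((P n z - P n w - l (ns_add z (ns_opp w))) +
      (H z - P n z - (H w - P n w))) by ring end.
  eapply Rle_trans; [apply Rabs_triang|]. lra.
Qed.

Lemma lipschitz_extension (Y : X -> Prop) (f : X -> R) L :
  is_closed Y -> is_convex Y -> 0 < L ->
  (forall y, Y y -> strict_diff Y f y) -> lipschitz_on Y L f ->
  exists H, smooth H /\ lipschitz (2 * (7 * C + 1) * L) H /\ forall y, Y y -> H y = f y.
Proof.
  intros HYc HYv HL Hf HfL. assert (HC1 : 1 <= C) by apply HC.
  destruct (classic (exists y0, Y y0)) as [[y0 Hy0]|Hno].
  2: { exists (fun _ => 0). split; [apply smooth_const|split].
       - intros x y _ _. rewrite Rminus_diag, Rabs_R0.
         apply Rmult_le_pos; [|apply dist_ge0]. apply Rmult_le_pos; lra.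
       - intros y Hy. exfalso. eauto. }
  destruct (correction_sequence Y f L y0 HYc HYv Hy0 HL Hf HfL) as [P [HS0 HS]].
  set (K := (7 * C + 1) * L) in *.
  assert (HK : 0 < K) by (apply Rmult_lt_0_compat; lra).
  destruct (choice (fun x l => forall n,
    Rabs (l - P n x) <= 2 * (K * ns_dist x y0) * (/ 2) ^ n)) as [H HH].
  { intros x. apply geometric_limit.
    - apply Rmult_le_pos; [lra|apply dist_ge0].
    - intros n. destruct (HS n) as [_ [_ [E1 Hlip]]].
      destruct (HS (S n)) as [_ [_ [E2 _]]].
      specialize (Hlip x y0 I I). simpl in Hlip. rewrite E1, E2 in Hlip.
      replace (P (S n) x - P n x - (f y0 - f y0))
        with (P (S n) x - P n x) in Hlip by ring. lra. }
  (* The tail of the series is summed on increments between [x] and [y], which are bounded by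
     [ns_dist x y]; its limit is then identified with the increment of [H - P n]. *)
  assert (Hlim : forall n, lipschitz (2 * K * (/ 2) ^ n) (fun x => H x - P n x)).
  { intros n x y _ _.
    destruct (geometric_limit (fun m => P (m + n)%nat x - P (m + n)%nat y - (P n x - P n y))
      (K * (/ 2) ^ n * ns_dist x y)) as [l Hl].
    { apply Rmult_le_pos; [|apply dist_ge0]. pose proof (half_pow_pos n). nra. }
    { intros m. destruct (HS (m + n)%nat) as [_ [_ [_ Hlip]]]. specialize (Hlip x y I I).
      simpl in Hlip. simpl plus. rewrite pow_add in Hlip.
      match type of Hlip with Rabs ?a <= _ => match goal with |- Rabs ?b <= _ =>
        replace b with a by ring end end.
      lra. }
    assert (El : Rabs (H x - P n x - (H y - P n y) - l) <= 0).
    { apply (geometric_small _ (2 * (K * ns_dist x y0) + 2 * (K * ns_dist y y0)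
        + 2 * (K * (/ 2) ^ n * ns_dist x y))).
      intros m. specialize (Hl m).
      assert (Hpow : forall z, Rabs (H z - P (m + n)%nat z) <= 2 * (K * ns_dist z y0) * (/ 2) ^ m).
      { intros z. eapply Rle_trans; [apply HH|]. rewrite pow_add.
        assert ((/ 2) ^ n <= 1 ^ n) by (apply pow_incr; lra). rewrite pow1 in *.
        pose proof (half_pow_pos m).
        assert (0 <= K * ns_dist z y0) by (apply Rmult_le_pos; [lra|apply dist_ge0]).
        rewrite <- Rmult_assoc. pose proof (half_pow_pos n).
        rewrite <- (Rmult_1_r (2 * (K * ns_dist z y0) * (/ 2) ^ m)) at 2.
        apply Rmult_le_compat_l; [|lra]. apply Rmult_le_pos; lra. }
      pose proof (Rabs_le_inv _ _ (Hpow x)). pose proof (Rabs_le_inv _ _ (Hpow y)).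
      apply Rabs_le_inv in Hl. apply Rabs_le. lra. }
    pose proof (Rabs_le_inv _ _ El) as El'. specialize (Hl 0%nat). simpl in Hl.
    apply Rabs_le_inv in Hl. apply Rabs_le. lra. }
  exists H. split; [|split].
  - apply (smooth_limit P H (2 * K)); auto. intros n. apply HS.
  - intros x y _ _. specialize (Hlim 0%nat x y I I). simpl in Hlim. rewrite !HS0 in Hlim.
    replace (H x - H y) with (H x - f y0 - (H y - f y0)) by ring.
    eapply Rle_trans; [apply Hlim|]. apply Req_le. unfold K. ring.
  - intros y Hy. apply Rminus_diag_uniq.
    (* On [Y], [f - P n] vanishes at [y0] and is [L * 2^-n]-Lipschitz, so [P n] tends to [f]
       there. *)
    assert (Hz : Rabs (H y - f y) <= 0).
    { apply (geometric_small _ (2 * (K * ns_dist y y0) + L * ns_dist y y0)). intros n.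
      specialize (HH y n). destruct (HS n) as [_ [HfS [E _]]].
      specialize (HfS y y0 Hy Hy0). simpl in HfS. rewrite E in HfS.
      apply Rabs_le_inv in HH. apply Rabs_le_inv in HfS. apply Rabs_le. lra. }
    pose proof (Rabs_le_inv _ _ Hz). lra.
Qed.

Lemma smooth_extension (Y : X -> Prop) (f : X -> R) :
  is_closed Y -> is_convex Y -> (forall y, Y y -> strict_diff Y f y) ->
  exists H, smooth H /\ forall y, Y y -> H y = f y.
Proof.
  intros HYc HYv Hf.
  destruct (approximation C HC Y HYc HYv f 1 Rlt_0_1 Hf) as [g [Hg Hfg]].
  destruct (lipschitz_extension Y (fun x => f x - g x) 1) as [H [HH [_ HHf]]]; auto; [lra| |].
  - intros y Hy. apply strict_diff_sub; auto.
    apply (strict_diff_local Y (fun _ => True) g); auto. exists 1. split; [lra|auto].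
  - exists (fun x => H x + g x). split; [apply smooth_add; auto|].
    intros y Hy. rewrite HHf by auto. ring.
Qed.

(** A single extension has to satisfy the bound for every admissible constant, so it is built for
    the smallest one, which must therefore be attained. *)
Lemma least_lipschitz (Y : X -> Prop) (f : X -> R) :
  (exists L, 0 <= L /\ lipschitz_on Y L f) ->
  exists L, 0 <= L /\ lipschitz_on Y L f /\
    forall L', 0 <= L' -> lipschitz_on Y L' f -> L <= L'.
Proof.
  intros [L0 HL0].
  destruct (inf_exists (fun L => 0 <= L /\ lipschitz_on Y L f) 0) as [L [Hlow Hmax]].
  - exists L0. auto.
  - intros t [Ht _]. exact Ht.
  - exists L. split; [apply Hmax; intros t [Ht _]; exact Ht|split].
    + intros x y Hx Hy. destruct (dist_ge0 x y) as [Hpos|Hzero].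
      * apply Rmult_le_reg_r with (/ ns_dist x y); [apply Rinv_0_lt_compat; auto|].
        rewrite Rmult_assoc, Rinv_r, Rmult_1_r by lra.
        apply Hmax. intros t [_ Ht]. specialize (Ht x y Hx Hy).
        apply Rmult_le_reg_r with (ns_dist x y); auto.
        rewrite Rmult_assoc, Rinv_l, Rmult_1_r by lra. exact Ht.
      * pose proof (proj2 HL0 x y Hx Hy). rewrite <- Hzero in *. lra.
    + intros L' H0 H'. apply Hlow. auto.
Qed.

End Extension.

Theorem theorem1p4 (X : NormedSpace) (HX : complete X) (Hstar : property_star X) :
  (forall (Y U : X -> Prop) (f : X -> R),
     is_closed Y -> is_convex Y -> is_open U -> (forall y, Y y -> U y) ->
     C1_on Y f ->
     exists H : X -> R, C1_smooth H /\ forall y, Y y -> H y = f y)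
  /\
  (exists C : R, forall (Y U : X -> Prop) (f : X -> R),
     is_closed Y -> is_convex Y -> is_open U -> (forall y, Y y -> U y) ->
     C1_on Y f ->
     (exists L, 0 <= L /\ lipschitz_on Y L f) ->
     exists H : X -> R, C1_smooth H /\ (exists L, 0 <= L /\ lipschitz L H) /\
       (forall y, Y y -> H y = f y) /\
       (forall L, 0 <= L -> lipschitz_on Y L f -> lipschitz (C * L) H)).
Proof.
  destruct (property_star_constant Hstar) as [C HC]. assert (HC1 : 1 <= C) by apply HC.
  split.
  - intros Y U f HYc HYv _ _ Hf.
    destruct (smooth_extension C HC Y f HYc HYv) as [H [HH HHf]].
    { intros y Hy. apply C1_on_strict_diff; auto. }
    exists H. split; auto. apply smooth_C1_smooth; auto.
  - exists (2 * (7 * C + 1)). intros Y U f HYc HYv _ _ Hf HfL.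
    destruct (least_lipschitz Y f HfL) as [L [HL0 [HL Hmin]]].
    assert (Hext : exists H, smooth H /\ lipschitz (2 * (7 * C + 1) * L) H /\
      forall y, Y y -> H y = f y).
    { destruct HL0 as [HL0|HL0].
      - apply lipschitz_extension; auto. intros y Hy. apply C1_on_strict_diff; auto.
      (* The iteration needs a positive constant. For [L = 0], [f] is constant on [Y] and a constant
         function extends it. *)
      - rewrite <- HL0 in *. rewrite Rmult_0_r.
        assert (Hc : exists c, forall y, Y y -> c = f y).
        { destruct (classic (exists y, Y y)) as [[y0 Hy0]|Hno].
          - exists (f y0). intros y Hy. specialize (HL y0 y Hy0 Hy).
            rewrite Rmult_0_l in HL. apply Rabs_le_inv in HL. lra.
          - exists 0. intros y Hy. exfalso. eauto. }
        destruct Hc as [c Hc]. exists (fun _ => c). split; [apply smooth_const|split; auto].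
        intros x y _ _. rewrite Rminus_diag, Rabs_R0. lra. }
    destruct Hext as [H [HH [HHL HHf]]].
    exists H. split; [apply smooth_C1_smooth; auto|split; [|split; auto]].
    + exists (2 * (7 * C + 1) * L). split; auto. apply Rmult_le_pos; lra.
    + intros L' HL'0 HL'. apply (lipschitz_on_le _ (2 * (7 * C + 1) * L)); auto.
      apply Rmult_le_compat_l; [lra|auto].
Qed.
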